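(* Let $k\geq 2$ be an integer. Suppose that the edges of the complete graph $K_n$ ($n\ge 1$) are coloured with the colours red and blue, such that the red spanning subgraph is connected. Then the vertices of $K_n$ can be covered by a red tree $T$ with at most $k$ leaves and a blue balanced complete $(k+1)$-partite graph that is vertex-disjoint from $T$.
   Context: The red spanning subgraph is the graph with vertex set $V(K_n)$ whose edges are the red edges. A red tree is a subgraph of $K_n$ that is a tree and all of whose edges are red; its leaves are its vertices of degree $1$ (a single vertex is a tree). A balanced complete $r$-partite graph has its vertex set partitioned into $r$ sets $A_1,\dots,A_r$ with $|A_1|=\dots=|A_r|=m$ for some integer $m\ge 0$ ($m=0$, the empty graph, is allowed), with an edge between two vertices if and only if they lie in different sets $A_i$, $A_j$. A blue balanced complete $r$-partite graph in a coloured $K_n$ is a (not necessarily induced) subgraph of this form all of whose edges are blue; there is no restriction on the colours of edges of $K_n$ inside a part. *)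

(* Defs.v *)
From mathcomp Require Import all_boot.

Set Implicit Arguments.
Unset Strict Implicit.
Unset Printing Implicit Defensive.

(* A subgraph of the complete graph on V; an edge is a 2-element set. *)
Record graph (V : finType) := Graph {
  verts : {set V};
  edges : {set {set V}};
  edges_wf : [forall e in edges, (#|e| == 2) && (e \subset verts)]
}.

Definition adj (V : finType) (G : graph V) : rel V :=
  fun x y => [set x; y] \in edges G.

Definition degree (V : finType) (G : graph V) (x : V) : nat :=
  #|[set y | adj G x y]|.

Definition leaves (V : finType) (G : graph V) : {set V} :=
  [set x in verts G | degree G x == 1].

Definition connected (V : finType) (G : graph V) : Prop :=
  verts G != set0 /\
  {in verts G &, forall x y, connect (adj G) x y}.

Definition acyclic (V : finType) (G : graph V) : Prop :=
  forall p : seq V, 3 <= size p -> ~ ucycle (adj G) p.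

Definition tree (V : finType) (G : graph V) : Prop :=
  connected G /\ acyclic G.

Definition balanced_complete_partite (V : finType) (r : nat) (G : graph V) :
    Prop :=
  exists (m : nat) (A : 'I_r -> {set V}),
    [/\ forall i, #|A i| = m,
        forall i j, i != j -> [disjoint A i & A j],
        verts G = \bigcup_(i < r) A i
      & forall x y, adj G x y <->
          exists i j, [/\ i != j, x \in A i & y \in A j]].

Inductive colour := Red | Blue.

Definition is_red (a : colour) : bool := if a is Red then true else false.

(* Only the values on 2-element sets, the edges of the complete graph,
   are ever used. *)
Definition colouring (V : finType) := {set V} -> colour.

Definition monochromatic (V : finType) (c : colouring V) (a : colour)
    (G : graph V) : Prop :=
  forall e, e \in edges G -> c e = a.

Definition red_edges (V : finType) (c : colouring V) : {set {set V}} :=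
  [set e : {set V} | (#|e| == 2) && is_red (c e)].

Lemma red_edges_wf (V : finType) (c : colouring V) :
  [forall e in red_edges c, (#|e| == 2) && (e \subset [set: V])].
Proof.
by apply/forall_inP => e; rewrite inE subsetT andbT => /andP[].
Qed.

Definition red_spanning (V : finType) (c : colouring V) : graph V :=
  Graph (red_edges_wf c).

(* Main.v *)
Require Import Defs.
From mathcomp Require Import all_boot zify.

Set Implicit Arguments.
Unset Strict Implicit.
Unset Printing Implicit Defensive.

(** Among all red paths choose [b] such that the largest red component
    outside [b] is as small as possible, of size [d] say; among those, such
    that as few vertices as possible lie in components of size [d]; among
    those, the shortest.  If [b] misses some vertex, then ([cover_path])

    - an end of [b] has no red neighbour in a component of size [d], since
      the path could be extended to it;
    - no component has red edges to both ends, and the ends are not joined by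
      a red edge: otherwise [b] closes up to a red cycle, which can be opened
      next to a component of size [d] and extended into it;
    - the components with a red edge to a given end have together at least
      [d - 1] vertices, since otherwise that end could be dropped.

    When they have exactly [d - 1] vertices, the end is dropped after all and
    forms with them one component of size [d] ([expose_head]).  This leaves a
    red path and two disjoint families [A], [Z] of components, [A] attached to
    its first and [Z] to its last vertex, each with at least [d] and fewer
    than [2 * d] vertices; the other components have at most [d] vertices
    each, and at least [d] together.

    Search every component depth first and write down each vertex when it is
    entered and when it is left ([traversal_exists]).  Concatenate these
    words and cut the result at [k] places.  The vertices whose two
    occurrences are separated by a given cut are the stack of the search at
    that moment, a red path hanging from [b]; so [b] and the [k] stacks form a
    red tree.  Vertices visited completely in different slices have no red
    edge between them, so if each of the [k + 1] slices holds equally many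
    visits, then these form the blue graph.  The leaves of the tree are the
    tops of the stacks and perhaps the ends of [b].  An empty stack has no
    top; and the first end of [b] is no leaf if the first cut falls within a
    word of [A], as does the last end for the last cut and [Z].  So there are
    at most [k] leaves as soon as the first cut has its stack in [A] and the
    last one in [Z] ([cover_from_slices]).

    It remains to order the words such that [k] balanced cuts have this
    property ([balanced_cuts]).  Use the order P A ... Z Q, in which P and Q
    are the longest initial parts of two fixed lists with at most [m]
    vertices, and let [m] grow.  As long as there are cuts with at least [m]
    visits in every slice, either there are cuts with exactly [m] in every
    slice, or there are cuts with at least [m + 1] ([exact_or_more]); in the
    second case, a block that completes P to exactly [m + 1] vertices may jump
    over [A] ([front_hop]), and likewise for Q.  So for some [m] the order
    that belongs to [m] has an exact solution, and
    |P| <= m < |P| + |A| forces the first cut into [A]. *)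

(** * Words and their slices *)

Section Words.
Variable V : finType.
Implicit Types (s u v w : seq V) (x y : V).

(** Kept opaque to simplification, unlike [count_mem]. *)
Definition occ x u : nat := count_mem x u.

Lemma occ_cat x u v : occ x (u ++ v) = occ x u + occ x v.
Proof. exact: count_cat. Qed.

Lemma occ_rev x u : occ x (rev u) = occ x u.
Proof. exact: count_rev. Qed.

Lemma occ_cons x y u : occ x (y :: u) = (y == x) + occ x u.
Proof. by []. Qed.

Lemma occ0 x u : x \notin u -> occ x u = 0.
Proof. by move/count_memPn. Qed.

(** In the words below a vertex is written when a search enters it and when
    it leaves it, so these are the vertices visited entirely within [u]. *)
Definition pairs u : {set V} := [set x | occ x u == 2].
Definition cnt u := #|pairs u|.
Definition twice u := forall x, occ x u <= 2.
Definition paired u := forall x, x \in u -> occ x u = 2.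
Definition disj u v := forall x, x \in u -> x \notin v.

Lemma cnt_nil : cnt [::] = 0.
Proof. by apply/eqP; rewrite cards_eq0; apply/eqP/setP=> x; rewrite !inE. Qed.

Lemma mem_count x u : (x \in u) = (0 < occ x u).
Proof. by rewrite /occ -has_count has_pred1. Qed.

Lemma cnt_rev u : cnt (rev u) = cnt u.
Proof. by apply: eq_card => x; rewrite !inE occ_rev. Qed.

Lemma twice_catl u v : twice (u ++ v) -> twice u.
Proof. by move=> h x; have := h x; rewrite occ_cat; lia. Qed.

Lemma twice_catr u v : twice (u ++ v) -> twice v.
Proof. by move=> h x; have := h x; rewrite occ_cat; lia. Qed.

Lemma cnt_cat_ge u v : twice (u ++ v) -> cnt u + cnt v <= cnt (u ++ v).
Proof.
move=> h; rewrite /cnt -cardsUI.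
have -> : pairs u :&: pairs v = set0.
  by apply/setP=> x; rewrite !inE; have := h x; rewrite occ_cat; lia.
rewrite cards0 addn0; apply/subset_leq_card/subsetP=> x; rewrite !inE.
by have := h x; rewrite occ_cat; lia.
Qed.

Lemma cnt_cat_lt u v x : twice (u ++ v) -> x \in u -> x \in v ->
  cnt u + cnt v < cnt (u ++ v).
Proof.
move=> h xu xv; rewrite /cnt -cardsUI.
have -> : pairs u :&: pairs v = set0.
  by apply/setP=> y; rewrite !inE; have := h y; rewrite occ_cat; lia.
rewrite cards0 addn0; apply/proper_card/properP; split.
  apply/subsetP=> y; rewrite !inE.
  by have := h y; rewrite occ_cat; lia.
move: xu xv; rewrite !mem_count => xu xv.
by exists x; rewrite !inE; have := h x; rewrite occ_cat; lia.
Qed.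

Lemma cnt_cat u v : disj u v -> cnt (u ++ v) = cnt u + cnt v.
Proof.
move=> d; rewrite /cnt -[RHS]cardsUI.
have dc x : occ x u = 0 \/ occ x v = 0.
  have [xu|] := boolP (x \in u); last by rewrite mem_count; lia.
  by have := d x xu; rewrite mem_count; lia.
have -> : pairs u :&: pairs v = set0.
  by apply/setP=> x; rewrite !inE; have := dc x; lia.
rewrite cards0 addn0; apply: eq_card => x; rewrite !inE occ_cat.
by have := dc x; lia.
Qed.

Lemma paired_disjl u v : twice (u ++ v) -> paired u -> disj u v.
Proof.
move=> h cu x xu; have := h x; rewrite occ_cat (cu x xu) mem_count; lia.
Qed.

Lemma paired_disjr u v : twice (u ++ v) -> paired v -> disj u v.
Proof.
move=> h cv x xu; apply/negP=> xv; have := h x.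
by rewrite occ_cat (cv x xv); move: xu; rewrite mem_count; lia.
Qed.

Lemma cnt_pairedl u v : twice (u ++ v) -> paired u ->
  cnt (u ++ v) = cnt u + cnt v.
Proof. by move=> h cu; apply/cnt_cat/paired_disjl. Qed.

Lemma cnt_pairedr u v : twice (u ++ v) -> paired v ->
  cnt (u ++ v) = cnt u + cnt v.
Proof. by move=> h cu; apply/cnt_cat/paired_disjr. Qed.

Lemma paired_cat u v : twice (u ++ v) -> paired u -> paired v ->
  paired (u ++ v).
Proof.
move=> h cu cv x; rewrite mem_cat occ_cat; have := h x.
rewrite occ_cat => hx /orP[/cu|/cv]; lia.
Qed.

(** [k] is the number of cuts; the word falls into [k.+1] slices. *)
Fixpoint parts (Q : pred (seq V)) k w : Prop :=
  if k is k'.+1 then exists u v, [/\ w = u ++ v, Q u & parts Q k' v]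
  else Q w.

Definition atleast m : pred (seq V) := fun u => m <= cnt u.
Definition exactly m : pred (seq V) := fun u => cnt u == m.

Lemma partsP Q k w : parts Q k w <->
  exists ss, [/\ size ss = k.+1, flatten ss = w & all Q ss].
Proof.
elim: k w => [|k IH] w /=; split.
- by move=> Qw; exists [:: w]; rewrite /= cats0 Qw.
- by case=> -[|s [|? ?]] [] //= _; rewrite cats0 andbT => ->.
- case=> u [v [-> Qu /IH[ss [szs <- a]]]].
  by exists (u :: ss); rewrite /= szs Qu.
- case=> -[|s ss] [] //= [szs] <- /andP[Qs a].
  by exists s, (flatten ss); split=> //; apply/IH; exists ss.
Qed.

Lemma flatten_rev (T : Type) (ss : seq (seq T)) :
  flatten (rev (map rev ss)) = rev (flatten ss).
Proof.
elim: ss => //= s ss IH.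
by rewrite rev_cons -cats1 flatten_cat /= cats0 IH rev_cat.
Qed.

Lemma parts_rev (Q : pred (seq V)) k w : (forall u, Q (rev u) = Q u) ->
  parts Q k w -> parts Q k (rev w).
Proof.
move=> Qr /partsP[ss [szs <- a]]; apply/partsP.
exists (rev (map rev ss)); rewrite size_rev size_map flatten_rev all_rev all_map.
by split=> //; rewrite (eq_all (a2 := Q)).
Qed.

Lemma parts_atleast_rev m k w :
  parts (atleast m) k w -> parts (atleast m) k (rev w).
Proof. by apply: parts_rev => u; rewrite /atleast cnt_rev. Qed.

Lemma parts_prefix m k u v : twice (u ++ v) ->
  parts (atleast m) k v -> parts (atleast m) k (u ++ v).
Proof.
case: k => [|k] /= tw; rewrite /atleast.
  by have := cnt_cat_ge tw; lia.
case=> s [t [ev h p]]; exists (u ++ s), t; split=> //; first by rewrite ev catA.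
move: tw; rewrite ev catA => /twice_catl/cnt_cat_ge; lia.
Qed.

Lemma parts_mono m m' k w : m <= m' -> parts (atleast m') k w ->
  parts (atleast m) k w.
Proof.
move=> le /partsP[ss [h1 h2 h3]]; apply/partsP; exists ss; split=> //.
by apply: sub_all h3 => u; rewrite /atleast; lia.
Qed.

Lemma parts_atleast_sum m k w : twice w -> parts (atleast m) k w ->
  k.+1 * m <= cnt w.
Proof.
elim: k w => [|k IH] w tw /=; first by rewrite mul1n.
case=> u [v [ew h /IH p]]; have := cnt_cat_ge (u := u) (v := v).
rewrite -ew => /(_ tw); have := p; rewrite ew in tw.
by have := twice_catr tw; rewrite /atleast in h => t /(_ t); lia.
Qed.

Lemma exactly_atleast m k w : parts (exactly m) k w -> parts (atleast m) k w.
Proof.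
move=> /partsP[ss [h1 h2 h3]]; apply/partsP; exists ss; split=> //.
by apply: sub_all h3 => u; rewrite /atleast/exactly; lia.
Qed.

Lemma cnt_cons_le x u : cnt (x :: u) <= (cnt u).+1.
Proof.
apply: leq_trans (_ : #|x |: pairs u| <= _); last by rewrite cardsU1 -/(cnt u); lia.
apply/subset_leq_card/subsetP=> y; rewrite !inE occ_cons.
by rewrite [y == x]eq_sym; case: (x == y).
Qed.

Lemma cnt_cons_notin x u : x \notin u -> cnt (x :: u) = cnt u.
Proof.
move=> xu; apply: eq_card => y; rewrite !inE occ_cons.
by case: (eqVneq x y) => [<-|//]; rewrite (occ0 xu).
Qed.

Lemma cnt_rcons_le u x : cnt (rcons u x) <= (cnt u).+1.
Proof. by rewrite -cnt_rev rev_rcons -[cnt u]cnt_rev cnt_cons_le. Qed.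

Lemma cnt_rcons_notin u x : x \notin u -> cnt (rcons u x) = cnt u.
Proof.
move=> h; rewrite -cnt_rev rev_rcons -[cnt u]cnt_rev cnt_cons_notin //.
by rewrite mem_rev.
Qed.

(** Losing the first letter destroys a pair only if that letter recurs, and
    then at most one. *)
Lemma parts_behead m k x v : 0 < m + (x \in v) ->
  parts (atleast (m + (x \in v))) k (x :: v) ->
  parts (atleast m) k v.
Proof.
case: k => [|k] /=; rewrite /atleast => m0.
  by have := cnt_cons_le x v; have := @cnt_cons_notin x v;
     case: (x \in v) => /= [_|/(_ isT)]; lia.
case=> [[|y u] [t [//=]]]; first by move=> _; rewrite cnt_nil leqn0; lia.
move=> [<- ->]; rewrite mem_cat => h p; exists u, t; split=> //; last first.
  by apply: parts_mono p; lia.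
have := cnt_cons_le x u; have := @cnt_cons_notin x u.
by move: h; case: (x \in u) => /= h; [move=> _|move=> /(_ isT)]; lia.
Qed.

(** Each letter raises [cnt] by at most one. *)
Lemma prefix_exact m w : m <= cnt w -> exists u v, w = u ++ v /\ cnt u = m.
Proof.
elim/last_ind: w m => [|w x IH] m.
  by rewrite cnt_nil leqn0 => /eqP->; exists [::], [::]; rewrite cnt_nil.
move=> h; have [/IH[u [v [-> <-]]]|lt] := leqP m (cnt w).
  by exists u, (rcons v x); rewrite rcons_cat.
by exists (rcons w x), [::]; rewrite cats0; split=> //; have := cnt_rcons_le w x; lia.
Qed.

(** The first cut lies between [u] and [v] and moves right letter by letter.
    If a letter closes a pair, then its first occurrence lies in [u], so [v]
    loses no pair with it and the slices after the cut keep [m.+1] pairs; if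
    it closes none, then [u] keeps [m] pairs, and the hypothesis on [k] cuts
    tells whether [v] has become balanced. *)
Lemma move_first_cut m k u v :
    (forall v', twice v' -> parts (atleast m) k v' ->
       parts (exactly m) k v' \/ parts (atleast m.+1) k v') ->
    twice (u ++ v) -> cnt u = m -> parts (atleast m.+1) k v ->
  parts (exactly m) k.+1 (u ++ v) \/ parts (atleast m.+1) k.+1 (u ++ v).
Proof.
move=> IHk; elim: v u => [|x v IH] u tw cu p.
  by have := parts_atleast_sum (twice_catr tw) p; rewrite cnt_nil leqn0 muln_eq0.
have xu1 : x \in u -> x \notin v.
  move=> xu; have := tw x; rewrite occ_cat occ_cons eqxx.
  by move: xu; rewrite !mem_count; lia.
have [xv|xv] := boolP (x \in v).
  have xu : x \notin u by apply/negP=> /xu1; rewrite xv.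
  have p1 : parts (atleast m) k v.
    apply: (@parts_behead m k x); rewrite xv addn1 //.
  case: (IHk v _ p1) => [|pe|pp]; first by move: tw => /twice_catr/(twice_catr (u:=[::x])).
    left; exists (rcons u x), v; rewrite cat_rcons; split=> //.
    by rewrite /exactly cnt_rcons_notin ?cu.
  by rewrite -cat_rcons; apply: IH; rewrite ?cat_rcons ?cnt_rcons_notin.
have p1 : parts (atleast m.+1) k v.
  by apply: (@parts_behead m.+1 k x); rewrite (negPf xv) addn0.
have [le|gt] := leqP (cnt (rcons u x)) m; last first.
  by right; exists (rcons u x), v; rewrite cat_rcons.
rewrite -cat_rcons; apply: IH; rewrite ?cat_rcons //.
apply/eqP; rewrite eqn_leq le -cats1 -{1}cu.
apply: leq_trans (_ : cnt u + cnt [:: x] <= _); first by lia.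
by apply/cnt_cat_ge; rewrite cats1; move: tw; rewrite -cat_rcons => /twice_catl.
Qed.

(** Discrete continuity of the largest possible smallest slice. *)
Lemma exact_or_more m k w : twice w -> parts (atleast m) k w ->
  parts (exactly m) k w \/ parts (atleast m.+1) k w.
Proof.
elim: k w => [|k IH] w tw.
  rewrite /= /atleast /exactly leq_eqVlt => /orP[/eqP->|]; by [left|right].
case=> s [t [ew h p]]; have [u [v [es cu]]] := prefix_exact h.
have tw' : twice (u ++ v ++ t) by rewrite catA -es -ew.
have p' : parts (atleast m) k (v ++ t).
  by apply: parts_prefix p; apply: twice_catr tw'.
have -> : w = u ++ (v ++ t) by rewrite catA -es.
case: (IH _ (twice_catr tw') p') => [pe|pp].
  by left; exists u, (v ++ t); rewrite /exactly cu eqxx.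
by apply: move_first_cut.
Qed.

Lemma cat_split (T : Type) (a b c d : seq T) : a ++ b = c ++ d ->
  (exists a', a = c ++ a' /\ d = a' ++ b) \/
  (exists b', c = a ++ b' /\ b = b' ++ d).
Proof.
elim: a c => [|z a IH] [|y c] /=.
- by move=> ->; right; exists [::].
- by move=> ->; right; exists (y :: c).
- by move=> <-; left; exists (z :: a).
- by move=> [-> /IH[[a' [-> ->]]|[b' [-> ->]]]]; [left; exists a'|right; exists b'].
Qed.

Lemma parts_drop0 m k u v : 0 < m -> twice (u ++ v) -> disj u v ->
  cnt u = 0 -> parts (atleast m) k (u ++ v) -> parts (atleast m) k v.
Proof.
move=> m0 tw d c0; case: k => [|k] /=; rewrite /atleast.
  by rewrite (cnt_cat d) c0.
case=> s [t [/cat_split[[u' [eu et]]|[v' [es ev]]] h p]].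
  by move: tw => /twice_catl; rewrite eu => /cnt_cat_ge; rewrite -eu c0; lia.
exists v', t; split=> //; move: h; rewrite es cnt_cat ?c0 // => x /d.
by rewrite ev mem_cat negb_or => /andP[].
Qed.

Lemma disj_catl u v w : disj (u ++ v) w -> disj u w /\ disj v w.
Proof. by move=> d; split=> x h; apply: d; rewrite mem_cat h ?orbT. Qed.

Lemma disj_catr u v w : disj u (v ++ w) -> disj u v /\ disj u w.
Proof.
by move=> d; split=> x /d; rewrite mem_cat negb_or => /andP[].
Qed.

Lemma twice_cut u v w : twice (u ++ v ++ w) -> twice (u ++ w).
Proof. by move=> h x; have := h x; rewrite !occ_cat; lia. Qed.

(** One slice fewer suffices without [E].  If [E] is not cut, the slice
    around it may be merged with the next.  If it is cut once, the two slices
    that it is divided between merge into one with at least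
    [2 * m - cnt E >= m] pairs.  If a slice lies inside [E], it takes up all
    its pairs, and the slices beside it are large enough without [E]. *)
Lemma parts_remove_block m k X E R :
    0 < m -> twice (X ++ E ++ R) -> disj X E -> disj X R -> disj E R ->
    cnt E <= m ->
  parts (atleast m) k.+1 (X ++ E ++ R) -> parts (atleast m) k (X ++ R).
Proof.
move=> m0; elim: k X => [|k IH] X tw dXE dXR dER cE [u [v [ew hu pv]]].
  move: pv hu; rewrite /= /atleast (cnt_cat dXR).
  case/cat_split: ew => [[X' [eX ev]]|[t [eu /cat_split[[E' [eE ev]]|[R' [et eR]]]]]].
  - by move: tw => /twice_catl; rewrite eX => /cnt_cat_ge; lia.
  - have tE : twice E by move: tw => /twice_catr/twice_catl.
    rewrite eE in dXE dER tE cE; have := cnt_cat_ge tE.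
    have [d1 _] := disj_catr dXE; have [_ d2] := disj_catl dER.
    by rewrite eu ev (cnt_cat d1) (cnt_cat d2); lia.
  - move: tw => /twice_catr/twice_catr; rewrite eR => /cnt_cat_ge; lia.
case/cat_split: ew => [[X' [eX ev]]|[t [eu /cat_split[[E' [eE ev]]|[R' [et eR]]]]]].
- rewrite eX -catA; exists u, (X' ++ R); split=> //; apply: IH => //.
  + by move: tw; rewrite eX -catA => /twice_catr.
  + by have := dXE; rewrite eX => /disj_catl[].
  + by have := dXR; rewrite eX => /disj_catl[].
  + by rewrite -ev.
- have tE : twice E by move: tw => /twice_catr/twice_catl.
  have dXE' := dXE; have dER' := dER; have tE' := tE.
  rewrite eE in dXE' dER' tE'; have g1 := cnt_cat_ge tE'; rewrite -eE in g1.
  have [d1 _] := disj_catr dXE'; have [_ d2] := disj_catl dER'.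
  rewrite /atleast eu (cnt_cat d1) in hu.
  case: pv => s [r [es hs pr]]; rewrite ev in es.
  case/cat_split: es => [[E2 [eE' er]]|[R1 [e1 e2]]]; last first.
    exists (X ++ R1), r; split=> //; first by rewrite e2 catA.
    rewrite e1 /atleast in hs; rewrite e2 in dXR d2.
    have [d3 _] := disj_catr dXR; have [d4 _] := disj_catr d2.
    by move: hs; rewrite /atleast (cnt_cat d3) (cnt_cat d4); lia.
  rewrite eE' in tE' d2; have g2 := cnt_cat_ge (twice_catr tE').
  rewrite -eE' in g2; rewrite /atleast in hs.
  exists X, R; split; rewrite /atleast //; first by lia.
  apply: (@parts_drop0 m k E2) => //; last by rewrite -er.
  + by move: tw; rewrite eE eE' -!catA => /twice_catr/twice_catr/twice_catr.
  + by have [] := disj_catl d2.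
  + by lia.
- by rewrite eR catA; apply: (@parts_prefix m k.+1) pv; rewrite -catA -eR;
     apply: twice_cut tw.
Qed.

(** If the first cut lies within [Y], then [Y] and [A] both have exactly [m]
    pairs, and [A] can serve as the first slice. *)
Lemma parts_replace_head m k A Y R :
    0 < m -> twice (Y ++ R) -> disj Y R -> twice (A ++ R) -> disj A R ->
    cnt Y <= cnt A <= m ->
  parts (atleast m) k (Y ++ R) -> parts (atleast m) k (A ++ R).
Proof.
move=> m0 tY dY tA dA /andP[YA Am]; case: k => [|k] /=.
  by rewrite /atleast !cnt_cat //; lia.
case=> s [t [/cat_split[[Y' [eY et]]|[R' [es eR]]] hs p]].
  have g : cnt s + cnt Y' <= cnt Y.
    by move: tY => /twice_catl; rewrite eY => /cnt_cat_ge.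
  rewrite /atleast in hs; exists A, R; split=> //; first by rewrite /atleast; lia.
  rewrite et in p; apply: parts_drop0 p => //; last by lia.
    by move: tY; rewrite eY -catA => /twice_catr.
  by move: dY; rewrite eY => /disj_catl[].
exists (A ++ R'), t; split=> //; first by rewrite eR catA.
rewrite eR in dA dY; have [d1 _] := disj_catr dA; have [d2 _] := disj_catr dY.
by move: hs; rewrite es /atleast !cnt_cat //; lia.
Qed.

(** The first slice uses up at least [m] of the pairs of [Y]; at most [cnt A]
    of them remain. *)
Lemma parts_exchange m k A Y R :
    0 < m -> twice (Y ++ R) -> disj Y R -> twice (A ++ R) -> disj A R ->
    cnt A <= m -> cnt Y <= m + cnt A ->
  parts (atleast m) k.+1 (Y ++ R) -> parts (atleast m) k (A ++ R).
Proof.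
move=> m0 tY dY tA dA Am YA [s [t [/cat_split[[Y' [eY et]]|[R' [es eR]]] hs p]]].
  have g : cnt s + cnt Y' <= cnt Y.
    by move: tY => /twice_catl; rewrite eY => /cnt_cat_ge.
  rewrite /atleast in hs; rewrite et in p; apply: parts_replace_head p => //.
  - by move: tY; rewrite eY -catA => /twice_catr.
  - by move: dY; rewrite eY => /disj_catl[].
  - by lia.
by rewrite eR catA; apply: parts_prefix p; rewrite -catA -eR.
Qed.

Lemma paired_flatten gs : twice (flatten gs) ->
  (forall g, g \in gs -> paired g) -> paired (flatten gs).
Proof.
elim: gs => [|g gs IH] //= tw c; apply: paired_cat => //.
  by apply: c; rewrite mem_head.
by apply: IH => [|g' g'gs]; [apply: twice_catr tw|apply: c; rewrite inE g'gs orbT].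
Qed.

(** * Orders in which blocks have jumped over a distinguished word *)

Definition front i A (gs : seq (seq V)) : seq V :=
  flatten (take i gs) ++ A ++ flatten (drop i gs).

Definition psum i (gs : seq (seq V)) := cnt (flatten (take i gs)).

Lemma occ_front x i A gs : occ x (front i A gs) = occ x A + occ x (flatten gs).
Proof.
by rewrite -{2}(cat_take_drop i gs) flatten_cat /front !occ_cat; lia.
Qed.

(** The last clause makes any two or more blocks that stand before [A] at
    least as large as [A]: this is the condition [cnt A <= m] of
    [parts_exchange].  When no block stands before [A] yet,
    [parts_remove_block] serves instead. *)
Definition blocks A gs :=
  [/\ paired A, forall g, g \in gs -> paired g,
      forall g, g \in gs -> 0 < cnt g &
      forall g1 g2 l, gs = g1 :: g2 :: l -> cnt A <= cnt g1 + cnt g2].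

Lemma front_split i A gs : i < size gs ->
  front i A gs =
    flatten (take i gs) ++ A ++ nth [::] gs i ++ flatten (drop i.+1 gs).
Proof. by move=> lt; rewrite /front (drop_nth [::] lt). Qed.

Lemma front_splitS i A gs : i < size gs ->
  front i.+1 A gs =
    flatten (take i gs) ++ nth [::] gs i ++ A ++ flatten (drop i.+1 gs).
Proof.
by move=> lt; rewrite /front (take_nth [::] lt) flatten_rcons -catA.
Qed.

Lemma psumS i A gs : twice (flatten gs) -> blocks A gs -> i < size gs ->
  psum i.+1 gs = psum i gs + cnt (nth [::] gs i).
Proof.
move=> tw [_ cg _ _] lt; rewrite /psum (take_nth [::] lt) flatten_rcons.
apply: cnt_pairedr; last by apply/cg/mem_nth.
move: tw; rewrite -{1}(cat_take_drop i.+1 gs) flatten_cat => /twice_catl.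
by rewrite (take_nth [::] lt) flatten_rcons.
Qed.

Lemma psum_ge i A gs : twice (flatten gs) -> blocks A gs -> 0 < i < size gs ->
  cnt A <= psum i.+1 gs.
Proof.
case: gs i => [|g1 [|g2 l]] [|i] // tg [_ _ _ two] _.
apply: leq_trans (two _ _ _ erefl) _; rewrite /psum /=.
have tg' : twice (g1 ++ g2 ++ flatten (take i l)).
  by move: tg; rewrite /= -{1}(cat_take_drop i l) flatten_cat !catA => /twice_catl.
apply: leq_trans (cnt_cat_ge tg'); rewrite leq_add2l.
by have := cnt_cat_ge (twice_catr tg'); lia.
Qed.

(** After the jump the first [i.+1] blocks make up the first slice on their
    own, with exactly [m] pairs. *)
Lemma front_hop m k i A gs T0 :
    twice (front i A gs ++ T0) -> blocks A gs -> i < size gs ->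
    psum i.+1 gs = m -> parts (atleast m) k.+1 (front i A gs ++ T0) ->
  parts (atleast m) k.+1 (front i.+1 A gs ++ T0).
Proof.
move=> tw B lt; have [cA cg pg two] := B.
have tg : twice (flatten gs).
  by move=> x; have := tw x; rewrite occ_cat occ_front; lia.
have Nin : nth [::] gs i \in gs by apply: mem_nth.
have cE := cg _ Nin; have pE := pg _ Nin.
have cP : paired (flatten (take i gs)).
  apply: paired_flatten => [|g /mem_take/cg //].
  by move: tg; rewrite -{1}(cat_take_drop i gs) flatten_cat => /twice_catl.
rewrite (psumS tg B lt) => em; have m0 : 0 < m by lia.
move: tw; rewrite (front_split A lt) (front_splitS A lt) -!catA.
set P := flatten (take i gs) in cP em *; set E := nth _ _ _ in cE pE em *.
set R := _ ++ T0 => tw; rewrite -/(cnt P) in em => p.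
have tPE : twice (P ++ E).
  by move=> x; have := tw x; rewrite !occ_cat; lia.
exists (P ++ E), (A ++ R); split; rewrite -?catA //.
  by rewrite /atleast (cnt_pairedl tPE cP) -em leqnn.
have [i0|ipos] := posnP i.
  have P0 : P = [::] by rewrite /P i0 take0.
  rewrite /psum -/P P0 cnt_nil add0n in em; rewrite P0 /= in tw p.
  apply: (@parts_remove_block m k A E R) => //.
  - by apply: paired_disjr => //; move: tw; rewrite catA => /twice_catl.
  - by apply: paired_disjl => //; apply: twice_cut tw.
  - by apply: paired_disjl => //; apply: twice_catr tw.
  - by lia.
have tw' : twice ((P ++ A ++ E) ++ R) by rewrite -!catA.
have tAE : twice (A ++ E).
  by move=> x; have := tw x; rewrite !occ_cat; lia.
apply: (@parts_exchange m k A (P ++ A ++ E) R) => //.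
- apply: paired_disjl => //; apply: paired_cat => //.
    by apply: twice_catl tw'.
  by apply: paired_cat.
- by move=> x; have := tw x; rewrite !occ_cat; lia.
- by apply: paired_disjl => //; move=> x; have := tw x; rewrite !occ_cat; lia.
- by rewrite -em -(psumS tg B lt); apply: psum_ge; rewrite ?ipos.
- rewrite (cnt_pairedl (twice_catl tw') cP) (cnt_pairedl tAE cA).
  by rewrite -em /psum -/P; lia.
- by rewrite -!catA.
Qed.

(** As many blocks stand before the distinguished word as fit into [m]. *)
Definition at_level m i gs :=
  [/\ i <= size gs, psum i gs <= m & i < size gs -> m < psum i.+1 gs].

Lemma front_step m k i A gs T0 :
    twice (front i A gs ++ T0) -> blocks A gs -> at_level m i gs ->
    parts (atleast m.+1) k.+1 (front i A gs ++ T0) ->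
  exists i', at_level m.+1 i' gs /\
    parts (atleast m.+1) k.+1 (front i' A gs ++ T0).
Proof.
move=> tw B [le pm gt] p.
have tg : twice (flatten gs).
  by move=> x; have := tw x; rewrite occ_cat occ_front; lia.
have [lt|ge] := ltnP i (size gs); last first.
  by exists i; split=> //; split=> //; [exact: leqW|rewrite ltnNge ge].
have [e|ne] := eqVneq (psum i.+1 gs) m.+1; last first.
  by exists i; split=> //; split=> // [|_]; [exact: leqW|have := gt lt; lia].
exists i.+1; split; last exact: front_hop p.
split=> // [|lt2]; first by rewrite e.
rewrite (psumS tg B lt2) e; have [_ _ pg _] := B.
have : 0 < cnt (nth [::] gs i.+1) by apply/pg/mem_nth.
by lia.
Qed.

(** The second half is reversed, so that statements about the front of the
    word apply to its back after [rev]. *)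
Definition arrange i j A Z gs hs := front i A gs ++ rev (front j Z hs).

Lemma rev_arrange i j A Z gs hs :
  rev (arrange i j A Z gs hs) = arrange j i Z A hs gs.
Proof. by rewrite /arrange rev_cat revK. Qed.

Lemma occ_arrange x i j A Z gs hs : occ x (arrange i j A Z gs hs) =
  occ x A + occ x (flatten gs) + (occ x Z + occ x (flatten hs)).
Proof. by rewrite /arrange occ_cat occ_rev !occ_front. Qed.

(** Raise [m] from 0 and adapt the arrangement to it until the slices are
    exactly balanced; this happens before [m] exceeds the number of pairs. *)
Lemma balanced_level k A Z gs hs :
    twice (arrange 0 0 A Z gs hs) -> blocks A gs -> blocks Z hs ->
  exists m i j, [/\ at_level m i gs, at_level m j hs &
    parts (exactly m) k.+1 (arrange i j A Z gs hs)].
Proof.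
move=> tw0 BA BZ.
have tw i j : twice (arrange i j A Z gs hs).
  by move=> x; have := tw0 x; rewrite !occ_arrange.
have twr i j : twice (arrange i j Z A hs gs).
  by move=> x; have := tw0 x; rewrite !occ_arrange; lia.
have lvl0 B fs : twice (flatten fs) -> blocks B fs -> at_level 0 0 fs.
  move=> tf Bf; rewrite /at_level /psum take0 cnt_nil; split=> // lt.
  rewrite -/(psum 1 fs) (psumS tf Bf lt); have [_ _ pg _] := Bf.
  have : 0 < cnt (nth [::] fs 0) by apply/pg/mem_nth.
  by rewrite /psum take0 cnt_nil; lia.
have inv m : (exists m i j, [/\ at_level m i gs, at_level m j hs &
    parts (exactly m) k.+1 (arrange i j A Z gs hs)]) \/
  (exists i j, [/\ at_level m i gs, at_level m j hs &
    parts (atleast m) k.+1 (arrange i j A Z gs hs)]).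
  elim: m => [|m [|[i [j [li lj p]]]]]; try by left.
    right; exists 0, 0; split.
    - by apply: (lvl0 A) => // x; have := tw0 x; rewrite occ_arrange; lia.
    - by apply: (lvl0 Z) => // x; have := tw0 x; rewrite occ_arrange; lia.
    - apply/partsP; exists (nseq k.+1 [::] ++ [:: arrange 0 0 A Z gs hs]).
      rewrite size_cat size_nseq addn1 flatten_cat; split=> //.
        have -> n : flatten (nseq n [::]) = [::] :> seq V by elim: n.
        by rewrite /= cats0.
      by apply/allP=> u _; exact: leq0n.
  have [pe|pp] := exact_or_more (tw i j) p.
    by left; exists m, i, j.
  have [i' [li' p']] := front_step (tw i j) BA li pp.
  move/parts_atleast_rev: p'; rewrite -/(arrange i' j A Z gs hs) rev_arrange => p'.
  have [j' [lj' p'']] := front_step (twr j i') BZ lj p'.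
  right; exists i', j'; split=> //.
  by move/parts_atleast_rev: p''; rewrite -/(arrange j' i' Z A hs gs) rev_arrange.
have [//|[i [j [_ _ p]]]] := inv (cnt (arrange 0 0 A Z gs hs)).+1.
have := parts_atleast_sum (tw i j) p.
have -> : cnt (arrange i j A Z gs hs) = cnt (arrange 0 0 A Z gs hs).
  by apply: eq_card => x; rewrite !inE !occ_arrange.
by rewrite mulnS; lia.
Qed.

(** Before [A] the first slice has too few pairs, because an open visit is
    not counted; after [A] it has too many. *)
Lemma cut_position m P A R u v x :
    twice (P ++ A ++ R) -> paired P -> paired A -> P ++ A ++ R = u ++ v ->
    cnt P <= m < cnt P + cnt A -> cnt u = m -> x \in u -> x \in v -> x \in A.
Proof.
move=> tw cP cA e /andP[lo hi] cu xu xv.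
have tPA : twice (P ++ A) by move: tw; rewrite catA => /twice_catl.
have dP := paired_disjl tw cP.
case/cat_split: e => [[P2 [eP ev]]|[t [eu et]]].
  have tP := twice_catl tPA; rewrite eP in tP.
  have xP2 : x \in P2.
    have : x \in P by rewrite eP mem_cat xu.
    by move/dP; move: xv; rewrite ev mem_cat => /orP[//|->].
  by have := cnt_cat_lt tP xu xP2; rewrite -eP; lia.
case/cat_split: et => [[A2 [eA ev]]|[R' [et eR]]]; last first.
  have : cnt (P ++ A) <= cnt u.
    have tu : twice ((P ++ A) ++ R').
      by move: tw; rewrite eR !catA => /twice_catl.
    by rewrite eu et catA; apply: leq_trans (cnt_cat_ge tu); lia.
  by rewrite (cnt_pairedl tPA cP); lia.
move: xu; rewrite eu mem_cat => /orP[xP|xt]; last by rewrite eA mem_cat xt.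
by have := dP x xP; rewrite eA -catA -ev mem_cat xv orbT.
Qed.

Lemma flatten_flatten (T : Type) (l : seq (seq (seq T))) :
  flatten (flatten l) = flatten (map flatten l).
Proof. by elim: l => //= a l IH; rewrite flatten_cat IH. Qed.

Lemma cnt_arrange i j A Z gs hs : twice (arrange i j A Z gs hs) ->
  blocks A gs -> blocks Z hs ->
  cnt (arrange i j A Z gs hs) =
    cnt (flatten gs) + cnt A + (cnt Z + cnt (flatten hs)).
Proof.
move=> tw [cA cg _ _] [cZ ch _ _].
have tw1 : twice (flatten gs ++ A ++ Z ++ flatten hs).
  by move=> x; have := tw x; rewrite occ_arrange !occ_cat; lia.
have -> : cnt (arrange i j A Z gs hs) = cnt (flatten gs ++ A ++ Z ++ flatten hs).
  by apply: eq_card => x; rewrite !inE occ_arrange !occ_cat; congr (_ == _); lia.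
have cgs := paired_flatten (twice_catl tw1) cg.
by rewrite cnt_pairedl // cnt_pairedl ?cnt_pairedl ?addnA // => x;
   have := tw1 x; rewrite !occ_cat; lia.
Qed.

(** If all blocks stand before [A], the bound [m < psum i gs + cnt A] follows
    from counting: there are at least three slices, and a visit that is cut
    belongs to none of them, so [3 * m] is less than the number of pairs. *)
Lemma first_cut_in_block k m i j A Z gs hs u v x :
    0 < k -> twice (arrange i j A Z gs hs) -> blocks A gs -> blocks Z hs ->
    (forall g, g \in gs -> cnt g <= cnt A) ->
    cnt (arrange i j A Z gs hs) <= 3 * (cnt (flatten gs) + cnt A) ->
    at_level m i gs -> arrange i j A Z gs hs = u ++ v ->
    cnt u = m -> parts (exactly m) k v -> x \in u -> x \in v -> x \in A.
Proof.
move=> k0 tw BA BZ gA half [le lo hi] e cu pv xu xv.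
have tg : twice (flatten gs).
  by move=> y; have := tw y; rewrite occ_arrange; lia.
have [cA cg _ _] := BA.
have small : m < psum i gs + cnt A.
  have [lt|ge] := ltnP i (size gs).
    have := hi lt; rewrite (psumS tg BA lt).
    have : cnt (nth [::] gs i) <= cnt A by apply/gA/mem_nth.
    by lia.
  rewrite /psum take_oversize //.
  have tuv : twice (u ++ v) by rewrite -e.
  have := parts_atleast_sum (twice_catr tuv) (exactly_atleast pv).
  have := cnt_cat_lt tuv xu xv; rewrite -e cu.
  have : 2 * m <= k.+1 * m by rewrite leq_mul2r ltnS k0 orbT.
  by move: half; lia.
move: tw; rewrite /arrange /front -!catA => tw.
apply: (@cut_position m (flatten (take i gs)) A _ u v) tw _ cA _ _ cu xu xv.
- apply: paired_flatten => [|g /mem_take/cg //].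
  by move: tg; rewrite -{1}(cat_take_drop i gs) flatten_cat => /twice_catl.
- by rewrite -e /arrange /front -!catA.
- by rewrite lo small.
Qed.

(** The condition on the first two blocks is reached by merging them while
    they have together at most as many pairs as [A]. *)
Lemma group_blocks A l : paired A -> twice (flatten l) ->
    (forall g, g \in l -> [/\ paired g, 0 < cnt g & cnt g <= cnt A]) ->
  exists ls, [/\ flatten ls = l, blocks A (map flatten ls) &
    forall g, g \in map flatten ls -> cnt g <= cnt A].
Proof.
move=> cA; elim: l => [|g l IH] tw H; first by exists [::].
have tg : twice (flatten l) by apply: twice_catr tw.
have Hl f : f \in l -> [/\ paired f, 0 < cnt f & cnt f <= cnt A].
  by move=> fl; apply: H; rewrite inE fl orbT.
have [cg pg leg] := H _ (mem_head _ _).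
have [ls [el [_ cl pl two] lel]] := IH tg Hl.
case: ls el cl pl two lel => [|h ls] el cl pl two lel.
  exists [:: [:: g]]; rewrite -el /=; split=> //; last first.
    by move=> f; rewrite inE cats0 => /eqP->.
  by split=> // f; rewrite inE cats0 => /eqP->.
have ch : paired (flatten h) by apply: cl; rewrite mem_head.
have tgh : twice (g ++ flatten h).
  by move: tw; rewrite /= -el /= flatten_cat catA => /twice_catl.
have [lt|ge] := leqP (cnt A) (cnt g + cnt (flatten h)).
  exists ([:: g] :: h :: ls); rewrite /= -el; split=> //.
    split=> //.
    - by move=> f; rewrite inE cats0 => /orP[/eqP->|/cl].
    - by move=> f; rewrite inE cats0 => /orP[/eqP->|/pl].
    - by move=> g1 g2 l' []; rewrite cats0 => <- <-.
  by move=> f; rewrite inE cats0 => /orP[/eqP->|/lel].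
exists ((g :: h) :: ls); rewrite /= -el; split=> //.
  split=> //.
  - move=> f; rewrite inE => /orP[/eqP->|fl]; first exact: paired_cat.
    by apply: cl; rewrite inE fl orbT.
  - move=> f; rewrite inE => /orP[/eqP->|fl].
      by have := cnt_cat_ge tgh; lia.
    by apply: pl; rewrite inE fl orbT.
  - move=> g1 g2 l' [<- e]; have := two (flatten h) g2 l'; rewrite /= e => /(_ erefl).
    by have := cnt_cat_ge tgh; lia.
move=> f; rewrite inE => /orP[/eqP->|fl]; last by apply: lel; rewrite inE fl orbT.
by rewrite (cnt_pairedr tgh ch); lia.
Qed.

(** Words are moved to the second half until it has a third of the total.
    The last of them has at most [c] pairs, and the total is at least
    [3 * c], so more than a third remains for the first half. *)
Lemma split_thirds a z c l : twice (flatten l) ->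
    (forall f, f \in l -> paired f /\ cnt f <= c) ->
    c <= a < 2 * c -> c <= z < 2 * c -> c <= cnt (flatten l) ->
  exists l1 l2, [/\ l = l1 ++ l2,
    a + z + cnt (flatten l) <= 3 * (cnt (flatten l1) + a) &
    a + z + cnt (flatten l) <= 3 * (cnt (flatten l2) + z)].
Proof.
move=> tl Hl /andP[ca a2] /andP[cz z2] cl; set M := a + z + _.
have cut n : cnt (flatten l) =
    cnt (flatten (take n l)) + cnt (flatten (drop n l)).
  have tl' := tl; rewrite -(cat_take_drop n l) flatten_cat in tl'.
  rewrite -{1}(cat_take_drop n l) flatten_cat cnt_pairedl //.
  apply: paired_flatten => [|f /mem_take/Hl[] //].
  exact: twice_catl tl'.
have ex : exists n, M <= 3 * (cnt (flatten (take n l)) + a).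
  by exists (size l); rewrite take_size; lia.
case: (ex_minnP ex) => -[|n] h minn.
  exists [::], l; split=> //; last by lia.
  by move: h; rewrite take0.
have lt : n < size l.
  rewrite ltnNge; apply/negP=> ge; suff : n < n by rewrite ltnn.
  by apply: minn; move: h; rewrite !take_oversize // leqW.
exists (take n.+1 l), (drop n.+1 l); split=> //; first by rewrite cat_take_drop.
have lo : 3 * (cnt (flatten (take n l)) + a) < M.
  by rewrite ltnNge; apply/negP=> /minn; rewrite ltnn.
have [cf fc] := Hl _ (mem_nth [::] lt).
have st : cnt (flatten (take n.+1 l)) <= cnt (flatten (take n l)) + c.
  have tl' := tl; rewrite -(cat_take_drop n.+1 l) flatten_cat in tl'.
  move: tl' => /twice_catl; rewrite (take_nth [::] lt) flatten_rcons => t'.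
  by rewrite (cnt_pairedr t' cf) leq_add2l.
by have := cut n.+1; rewrite /M in lo *; lia.
Qed.

(** The words in the second list are reversed, and so is their order, which
    [arrange] undoes. *)
Lemma balanced_cuts k c A Z l :
    1 < k -> twice (flatten (A :: Z :: l)) ->
    (forall f, f \in A :: Z :: l -> paired f) ->
    (forall f, f \in l -> 0 < cnt f <= c) ->
    c <= cnt A < 2 * c -> c <= cnt Z < 2 * c -> c <= cnt (flatten l) ->
  exists ws ss m, [/\ perm_eq ws (A :: Z :: l), flatten ss = flatten ws,
    size ss = k.+1, all (exactly m) ss &
    (forall x, x \in flatten (take 1 ss) -> x \in flatten (drop 1 ss) ->
       x \in A) /\
    (forall x, x \in flatten (take k ss) -> x \in flatten (drop k ss) ->
       x \in Z)].
Proof.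
case: k => // k; rewrite ltnS => k0 tw cl Hl cA cZ cF.
have clA : paired A by apply: cl; rewrite mem_head.
have clZ : paired Z by apply: cl; rewrite !inE eqxx orbT.
have cll f : f \in l -> paired f by move=> fl; apply: cl; rewrite !inE fl !orbT.
have tl : twice (flatten l) by apply: twice_catr (twice_catr tw).
have [|l1 [l2 [el h1 h2]]] := @split_thirds (cnt A) (cnt Z) c l tl _ cA cZ cF.
  by move=> f fl; have := Hl f fl; split; [apply: cll|lia].
have mem1 f : f \in l1 -> f \in l by rewrite el mem_cat => ->.
have mem2 f : f \in l2 -> f \in l by rewrite el mem_cat => ->; rewrite orbT.
have paired_rev f : paired f -> paired (rev f).
  by move=> cf x; rewrite mem_rev occ_rev; apply: cf.
have occ_flat x : occ x (flatten l) = occ x (flatten l1) + occ x (flatten l2).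
  by rewrite el flatten_cat occ_cat.
have occ_frev x (fs : seq (seq V)) :
    occ x (flatten (map rev fs)) = occ x (flatten fs).
  by elim: fs => //= f fs IH; rewrite !occ_cat occ_rev IH.
have [||ggs [eg Bg gA]] := @group_blocks A l1 clA.
- by move=> x; have := tl x; rewrite occ_flat; lia.
- by move=> f /mem1 fl; have := Hl f fl; split; [apply: cll|lia|lia].
have [|||hhs [eh Bh hZ]] := @group_blocks (rev Z) (map rev l2).
- exact: paired_rev.
- by move=> x; have := tl x; rewrite occ_flat occ_frev; lia.
- move=> _ /mapP[f /mem2 fl ->]; rewrite !cnt_rev; have := Hl f fl.
  by split; [apply/paired_rev/cll|lia|lia].
set gs := map flatten ggs in Bg gA *; set hs := map flatten hhs in Bh hZ *.
have fg : flatten gs = flatten l1 by rewrite -flatten_flatten eg.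
have fh : flatten hs = flatten (map rev l2) by rewrite -flatten_flatten eh.
have twa i j : twice (arrange i j A (rev Z) gs hs).
  move=> x; rewrite occ_arrange fg fh occ_frev occ_rev; have := tw x.
  by rewrite /= !occ_cat occ_flat; lia.
have [m [i [j [li lj p]]]] := balanced_level k (twa 0 0) Bg Bh.
have cw : cnt (arrange i j A (rev Z) gs hs) = cnt A + cnt Z + cnt (flatten l).
  rewrite cnt_arrange // fg fh cnt_rev.
  have -> : cnt (flatten (map rev l2)) = cnt (flatten l2).
    by apply: eq_card => x; rewrite !inE occ_frev.
  have -> : cnt (flatten l) = cnt (flatten l1) + cnt (flatten l2).
    rewrite el flatten_cat cnt_pairedl //.
      by rewrite -flatten_cat -el.
    apply: paired_flatten => [x|f /mem1/cll //].
    by have := tl x; rewrite occ_flat; lia.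
  by lia.
pose ws := flatten (take i ggs) ++ A :: flatten (drop i ggs) ++
  rev (map rev (flatten (take j hhs) ++ rev Z :: flatten (drop j hhs))).
have fws : flatten ws = arrange i j A (rev Z) gs hs.
  rewrite /ws /arrange /front flatten_cat /= flatten_cat flatten_rev.
  rewrite flatten_cat /= !flatten_flatten !map_take !map_drop.
  by rewrite -!catA.
have [ss [szs fss a]] := (partsP _ _ _).1 p.
exists ws, ss, m; split=> //; first 1 last.
- by rewrite fss fws.
- have cutat t : arrange i j A (rev Z) gs hs =
      flatten (take t ss) ++ flatten (drop t ss).
    by rewrite -fss -flatten_cat cat_take_drop.
  split=> x xu xv.
    apply: (first_cut_in_block k0 (twa i j) Bg Bh gA _ li (cutat 1) _ _ xu xv).
    + by rewrite cw fg.
    + by case: (ss) szs a => [|s ss'] //= _ /andP[/eqP<- _]; rewrite take0 /= cats0.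
    + apply/partsP; exists (drop 1 ss); rewrite size_drop szs; split=> //.
      by apply/allP=> s /mem_drop; apply/allP.
  rewrite -mem_rev; rewrite -mem_rev in xu; rewrite -mem_rev in xv.
  have twb : twice (arrange j i (rev Z) A hs gs).
    by rewrite -rev_arrange => y; rewrite occ_rev; apply: twa.
  apply: (first_cut_in_block k0 twb Bh Bg hZ _ lj _ _ _ xv xu).
  + rewrite -rev_arrange cnt_rev cw fh cnt_rev.
    have -> : cnt (flatten (map rev l2)) = cnt (flatten l2).
      by apply: eq_card => y; rewrite !inE occ_frev.
    by [].
  + by rewrite -rev_arrange (cutat k.+1) rev_cat.
  + rewrite cnt_rev (drop_nth [::]) ?szs // drop_oversize ?szs //= cats0.
    by apply/eqP; move/allP: a; apply; apply: mem_nth; rewrite szs.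
  + apply: parts_rev => [u|]; first by rewrite /exactly cnt_rev.
    apply/partsP; exists (take k.+1 ss); rewrite size_take szs ltnSn; split=> //.
    by apply/allP=> s /mem_take; apply/allP.
- apply/permP=> q; rewrite /ws el count_cat /= count_cat count_rev count_map.
  rewrite count_cat /= revK count_cat.
  have <- : count q (flatten (take i ggs)) + count q (flatten (drop i ggs)) =
      count q l1 by rewrite -count_cat -flatten_cat cat_take_drop eg.
  have <- : count (preim rev q) (flatten (take j hhs)) +
      count (preim rev q) (flatten (drop j hhs)) = count q l2.
    rewrite -count_cat -flatten_cat cat_take_drop eh count_map.
    by apply: eq_count => f /=; rewrite revK.
  rewrite addnCA -!addnA; congr (_ + _); rewrite [RHS]addnCA; congr (_ + _).
  by rewrite [RHS]addnCA; congr (_ + _); rewrite addnCA.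
Qed.

End Words.

Arguments occ : simpl never.

(** * Depth-first traversals *)

Section Traversal.
Variables (V : finType) (e : rel V).
Implicit Types (s u v w : seq V) (x y : V) (S X : {set V}) (par : V -> V).

Lemma connect_inv (R : rel V) (P : pred V) x y :
  (forall a b, P a -> R a b -> P b) -> connect R x y -> P x -> P y.
Proof.
move=> H /connectP[p]; elim: p x => [|z p IH] x /=; first by move=> _ ->.
by case/andP=> xz pz ey Px; apply: IH pz ey (H _ _ Px xz).
Qed.

(** Stated through closed sets, since the traversal splits off part of [S]
    and no path needs to be followed through the rest. *)
Definition connected_from r S :=
  r \in S /\ forall X, r \in X ->
    (forall x y, x \in X -> x \in S -> y \in S -> e x y -> y \in X) ->
  S \subset X.

Definition childof par : rel V := fun p x => par x == p.

(** The search of [S] starts at [r], which hangs from [a].  At every moment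
    its stack is a chain of parents from [a], and there is no edge between a
    vertex that is finished and one that is not yet entered. *)
Record traversal a r S (s : seq V) par : Prop := Traversal {
  trav_occ : forall x, occ x s = 2 * (x \in S);
  trav_stack : forall u v, s = u ++ v -> exists q,
    path (childof par) a q /\ forall x, (x \in q) = (x \in u) && (x \in v);
  trav_sep : forall u v x y, s = u ++ v -> occ x u = 2 -> occ y v = 2 ->
    ~~ e x y;
  trav_red : forall x, x \in S -> e (par x) x;
  trav_par : forall x, x \in S -> par x = a \/ par x \in S;
  trav_root : par r = a;
  trav_head : exists t, s = r :: t
}.

Lemma trav_mem a r S s par x : traversal a r S s par -> (x \in s) = (x \in S).
Proof. by move=> T; rewrite mem_count (trav_occ T); case: (x \in S). Qed.

Lemma eq_in_path_child par1 par2 a q : {in q, par1 =1 par2} ->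
  path (childof par1) a q = path (childof par2) a q.
Proof.
elim: q a => //= z q IH a H; rewrite IH; last first.
  by move=> x xq; apply: H; rewrite inE xq orbT.
by rewrite /childof H ?mem_head.
Qed.

(** Split off the component [S1] of one neighbour [r'] of [r] in [S] without
    [r].  It is searched first, as a child of [r]; the rest [S2] is still
    connected from [r], and its word is continued after the first [r].  No
    edge joins [S1] to [S2] except at [r]. *)
Lemma traversal_exists a r S : connected_from r S -> e a r ->
  exists s par, traversal a r S s par.
Proof.
have [n] := ubnP #|S|; elim: n a r S => // n IH a r S; rewrite ltnS => Sn [rS cS] ear.
have [/exists_inP[r' r'S err']|/exists_inPn nor] :=
  boolP [exists y in S :\ r, e r y]; last first.
  have S1 x : (x \in S) = (x == r).
    apply/idP/eqP=> [xS|->//]; apply/set1P; move: x xS; apply/subsetP/cS.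
      exact: set11.
    move=> x y /set1P-> _ yS exy; apply/set1P/eqP.
    by apply: contraTT exy => yr; apply: nor; rewrite !inE yr.
  exists [:: r; r], (fun _ => a); split=> //=.
  - by move=> x; rewrite !occ_cons S1 eq_sym; case: (x == r).
  - case=> [|x [|y u]] v //=.
    + by move=> _; exists [::].
    + by move=> [<- <-]; exists [:: r]; rewrite /= /childof eqxx; split=> // b; rewrite inE andbb.
    + by move=> [_ _]; case: u => [|//] /= <-; exists [::]; split=> // b; rewrite andbF.
  - move=> u v x y /(congr1 size); rewrite size_cat /= => sz hx hy.
    have lx : occ x u <= size u by apply: count_size.
    have ly : occ y v <= size v by apply: count_size.
    by lia.
  - by move=> x; rewrite S1 => /eqP->.
  - by move=> x _; left.
  - by exists [:: r].
pose eR := [rel x y | [&& e x y, x \in S :\ r & y \in S :\ r]].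
pose S1 := [set x in S :\ r | connect eR r' x]; pose S2 := S :\: S1.
have clS1 x y : x \in S1 -> y \in S :\ r -> e x y -> y \in S1.
  rewrite !inE => /andP[xS cx] yS exy; rewrite yS.
  by apply: connect_trans cx (connect1 _); rewrite /= exy !inE xS yS.
have r'S1 : r' \in S1 by rewrite inE r'S connect0.
have rS1 : r \notin S1 by rewrite !inE eqxx.
have S1S x : x \in S1 -> x \in S by rewrite !inE -andbA => /and3P[].
have rS2 : r \in S2 by rewrite inE rS1.
have S2E x : (x \in S2) = (x \notin S1) && (x \in S) by rewrite inE.
have c1 : connected_from r' S1.
  split=> // X r'X cX; apply/subsetP=> x xS1.
  have : connect eR r' x by move: xS1; rewrite inE => /andP[].
  move/(@connect_inv eR (fun z => (z \in X) && (z \in S1))) => H.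
  suff /andP[] : (x \in X) && (x \in S1) by [].
  apply: H => [z y /andP[zX zS1] /and3P[ezy _ yS]|]; last by rewrite r'X.
  have yS1 := clS1 _ _ zS1 yS ezy.
  by rewrite yS1 (cX z y).
have c2 : connected_from r S2.
  split=> // X rX cX; apply/subsetP=> x; rewrite S2E => /andP[xS1 xS].
  have : x \in X :|: S1.
    move: x xS {xS1}; apply/subsetP; apply: cS => [|x y xX xS yS exy].
      by rewrite inE rX.
    have [yS1|yS1] := boolP (y \in S1); first by rewrite inE yS1 orbT.
    have [->|yr] := eqVneq y r; first by rewrite inE rX.
    have xS1 : x \notin S1.
      by apply: contra yS1 => xS1; apply: clS1 exy; rewrite // !inE yr.
    rewrite inE (cX x y) ?S2E ?xS1 ?yS1 //.
    by move: xX; rewrite inE (negPf xS1) orbF.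
  by rewrite inE (negPf xS1) orbF.
have lt1 : #|S1| < n.
  apply: leq_trans Sn; apply/proper_card/properP; split.
    by apply/subsetP.
  by exists r.
have lt2 : #|S2| < n.
  apply: leq_trans Sn; apply/proper_card/properP; split.
    by apply/subsetP=> x; rewrite S2E => /andP[].
  by exists r'; rewrite ?S2E ?r'S1 //; apply: S1S.
have [s1 [par1 T1]] := IH r r' S1 lt1 c1 err'.
have [s2 [par2 T2]] := IH a r S2 lt2 c2 ear.
have [t2 es2] := trav_head T2.
have m1 x : (x \in s1) = (x \in S1) by apply: trav_mem T1.
have m2 x : (x \in r :: t2) = (x \in S2) by rewrite -es2; apply: trav_mem T2.
have occr2 : occ r t2 = 1.
  by have := trav_occ T2 r; rewrite es2 occ_cons eqxx rS2 => -[].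
have rt2 : r \in t2 by rewrite mem_count occr2.
have dS x : x \in S1 -> x \notin S2 by rewrite S2E => ->.
pose par x := if x \in S1 then par1 x else par2 x.
exists (r :: s1 ++ t2), par; split.
- move=> x; rewrite occ_cons occ_cat (trav_occ T1).
  have := trav_occ T2 x; rewrite es2 occ_cons.
  have [xS1|xS1] := boolP (x \in S1).
    by rewrite (negPf (dS _ xS1)) (S1S _ xS1); lia.
  by rewrite S2E xS1 /=; lia.
- case=> [|z u] v /=; first by exists [::].
  case=> <- /cat_split[[s1' [es1 ev]]|[t' [eu et]]].
    have [q [pq mq]] := trav_stack T1 es1.
    have qS1 x : x \in q -> x \in S1.
      by rewrite mq -m1 es1 mem_cat => /andP[->].
    exists (r :: q); split.
      rewrite /= /childof {1}/par (negPf rS1) (trav_root T2) eqxx /=.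
      rewrite (eq_in_path_child (par2 := par1)) // => x /qS1.
      by rewrite /par => ->.
    move=> x; rewrite !inE mq ev mem_cat; have [->|xr] /= := eqVneq x r.
      by rewrite rt2 orbT.
    have [xu|//] := boolP (x \in u).
    have : x \in S1 by rewrite -m1 es1 mem_cat xu.
    by move/dS; rewrite -m2 inE negb_or => /andP[_ /negPf->]; rewrite orbF.
  have es2' : s2 = (r :: t') ++ v by rewrite es2 et.
  have [q [pq mq]] := trav_stack T2 es2'.
  have qS2 x : x \in q -> x \in S2.
    by rewrite mq -(trav_mem x T2) es2' mem_cat => /andP[->].
  exists q; split.
    rewrite (eq_in_path_child (par2 := par2)) // => x /qS2.
    by rewrite S2E /par => /andP[/negPf->].
  move=> x; rewrite mq eu !inE mem_cat; have [xv|//] := boolP (x \in v); rewrite ?andbF //.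
  have : x \in S2 by rewrite -m2 et inE mem_cat xv !orbT.
  by rewrite S2E -m1 => /andP[/negPf->].
- case=> [|z u] v x y /=; first by [].
  have nadj b d : b \in S1 -> d \in S2 -> d != r -> ~~ e b d.
    rewrite S2E => bS1 /andP[dS1 dS'] dr; apply: contra dS1.
    by apply: clS1; rewrite // !inE dr.
  have o1 b := trav_occ T1 b.
  have o2 b : (r == b) + occ b t2 = 2 * (b \in S2).
    by rewrite -(trav_occ T2) es2 occ_cons.
  have two2 : occ y t2 = 2 -> (y \in S2) && (y != r).
    move=> y2; have := o2 y; rewrite y2; case: (y \in S2); last by lia.
    by rewrite eq_sym; case: (r == y) => //; lia.
  case=> <- /cat_split[[s1' [es1 ev]]|[t' [eu et]]] hx hy.
    have {}o1 b : occ b u + occ b s1' = 2 * (b \in S1).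
      by rewrite -o1 es1 occ_cat.
    have xu : occ x u = 2.
      move: hx; rewrite occ_cons; case: eqVneq => // <-.
      by have := o1 r; rewrite (negPf rS1); lia.
    have xS1 : x \in S1 by have := o1 x; rewrite xu; case: (x \in S1) => //; lia.
    move: hy; rewrite ev occ_cat => hy.
    have [yS1|yS1] := boolP (y \in S1).
      apply: (trav_sep T1 es1 xu).
      by have := o2 y; rewrite (negPf (dS _ yS1)); lia.
    have /two2/andP[yS2 yr] : occ y t2 = 2.
      by have := o1 y; rewrite (negPf yS1); lia.
    exact: nadj.
  have /two2/andP[yS2 yr] : occ y t2 = 2.
    rewrite et occ_cat hy; have := o2 y; rewrite et occ_cat hy.
    by case: (y \in S2); lia.
  have [xS1|xS1] := boolP (x \in S1); first exact: nadj.
  apply: (trav_sep T2 (u := r :: t') (v := v)) => //; first by rewrite es2 et.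
  by move: hx; rewrite eu !occ_cons occ_cat o1 (negPf xS1).
- move=> x xS; rewrite /par; have [xS1|xS1] := boolP (x \in S1).
    exact: (trav_red T1).
  by apply: (trav_red T2); rewrite S2E xS1.
- move=> x xS; rewrite /par; have [xS1|xS1] := boolP (x \in S1).
    by have [->|/S1S] := trav_par T1 xS1; right.
  have xS2 : x \in S2 by rewrite S2E xS1.
  by have [->|] := trav_par T2 xS2; [left|rewrite S2E => /andP[_]; right].
- by rewrite /par (negPf rS1) (trav_root T2).
- by exists (s1 ++ t2).
Qed.

End Traversal.

(** * Trees given by parents, and blue multipartite graphs *)

Lemma set2_eq (V : finType) (x y z t : V) : [set x; y] = [set z; t] ->
  (x = z /\ y = t) \/ (x = t /\ y = z).
Proof.
move=> E.
have zE : z \in [set x; y] by rewrite E set21.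
have tE : t \in [set x; y] by rewrite E set22.
have xE : x \in [set z; t] by rewrite -E set21.
have yE : y \in [set z; t] by rewrite -E set22.
case/set2P: xE => ex; case/set2P: yE => ey; subst; auto.
  by move: tE; rewrite setUid => /set1P->; left.
by move: zE; rewrite setUid => /set1P->; left.
Qed.

Section Chains.
Variables (V : finType) (par : V -> V).
Implicit Types (x y : V) (q : seq V).

Lemma chain_par a q x : path (childof par) a q -> x \in q -> par x \in a :: q.
Proof.
elim: q a => //= h q IH a /andP[/eqP ph pq]; rewrite inE => /orP[/eqP->|xq].
  by rewrite ph mem_head.
by rewrite inE IH ?orbT.
Qed.

Lemma chain_iter a q x : path (childof par) a q -> x \in a :: q ->
  exists n, iter n par x = a.
Proof.
elim: q a => [|h q IH] a /=; first by rewrite inE => _ /eqP->; exists 0.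
case/andP=> /eqP ph pq; rewrite inE => /orP[/eqP->|xq]; first by exists 0.
by have [n en] := IH h pq xq; exists n.+1; rewrite iterS en.
Qed.

Lemma chain_next a q x : path (childof par) a q -> x \in a :: q ->
  x != last a q -> exists2 z, z \in q & par z = x.
Proof.
elim: q a => [|h q IH] a /=; first by rewrite inE => _ /eqP->; rewrite eqxx.
case/andP=> /eqP ph pq; rewrite inE => /orP[/eqP-> _|xq xl].
  by exists h; rewrite ?mem_head.
by have [z zq pz] := IH h pq xq xl; exists z; rewrite // inE zq orbT.
Qed.

Lemma chain_child a q x y : path (childof par) a q -> x \in q -> y \in q ->
  x != y -> exists2 z, z \in q & par z = x \/ par z = y.
Proof.
elim: q a => //= h q IH a /andP[_ pq].
have head_next t : t \in q -> exists2 z, z \in h :: q & par z = h.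
  case: (q) pq => // z r /= /andP[/eqP pz _] _.
  by exists z; rewrite // !inE eqxx orbT.
rewrite !inE => /orP[/eqP->|xq] /orP[/eqP->|yq]; rewrite ?eqxx // => xy.
- by have [z zq pz] := head_next _ yq; exists z; auto.
- by have [z zq pz] := head_next _ xq; exists z; auto.
- by have [z zq pz] := IH h pq xq yq xy; exists z; rewrite // inE zq orbT.
Qed.

Lemma parent_rank (T : {set V}) r :
    (forall x, x \in T -> x != r -> par x \in T) ->
    (forall x, x \in T -> exists n, iter n par x = r) ->
  exists rk : V -> nat, forall x, x \in T -> x != r -> rk (par x) < rk x.
Proof.
move=> clT reach.
have /fin_all_exists[rk rkP] : forall x, exists n : nat, x \in T ->
    iter n par x = r /\ forall m, iter m par x = r -> n <= m.
  move=> x; have [xT|xT] := boolP (x \in T); last by exists 0.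
  have ex : exists n, iter n par x == r by have [n /eqP] := reach x xT; exists n.
  case: (ex_minnP ex) => n /eqP en minn; exists n => _; split=> // m /eqP.
  exact: minn.
exists rk => x xT xr; have [ex _] := rkP x xT.
have [_ mn] := rkP _ (clT x xT xr).
case: (rk x) ex => [/eqP|n]; first by rewrite (negPf xr).
by rewrite iterSr => /mn.
Qed.

End Chains.

Section Colour.
Variables (V : finType) (c : colouring V).
Implicit Types (x y : V) (T : {set V}).

Definition red : rel V := fun x y => (x != y) && is_red (c [set x; y]).

Lemma red_sym : symmetric red.
Proof. by move=> x y; rewrite /red eq_sym setUC. Qed.

(** On a cycle, both neighbours of a vertex of largest rank would have to be
    its parent. *)
Lemma parent_tree T r par (rk : V -> nat) : r \in T ->
    (forall x, x \in T -> x != r -> par x \in T /\ red (par x) x) ->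
    (forall x, x \in T -> exists n, iter n par x = r) ->
    (forall x, x \in T -> x != r -> rk (par x) < rk x) ->
  exists G : graph V, [/\ verts G = T, tree G, monochromatic c Red G &
    forall x, x \in T -> x != r -> adj G x (par x) /\ adj G (par x) x].
Proof.
move=> rT parT reach rkP.
pose E := [set [set x; par x] | x in T :\ r].
have wf : [forall f in E, (#|f| == 2) && (f \subset T)].
  apply/forall_inP=> _ /imsetP[x /setD1P[xr xT] ->].
  have [pT /andP[ne _]] := parT x xT xr.
  by rewrite cards2 [x == _]eq_sym ne subUset !sub1set xT pT.
pose G := Graph wf.
have adjP x y : adj G x y -> (x \in T /\ x != r /\ y = par x) \/
    (y \in T /\ y != r /\ x = par y).
  case/imsetP=> z /setD1P[zr zT] /set2_eq[[-> ->]|[-> ->]]; by [left|right].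
have adjpar x : x \in T -> x != r -> adj G x (par x).
  by move=> xT xr; apply/imsetP; exists x; rewrite // !inE xr.
have asym : symmetric (adj G) by move=> x y; rewrite /adj setUC.
have toroot x : x \in T -> connect (adj G) x r.
  move=> xT; have [n] := reach x xT; elim: n x xT => [|n IH] x xT.
    by move=> /= ->; apply: connect0.
  rewrite iterSr; have [->|xr] := eqVneq x r; first by move=> _; apply: connect0.
  have [pT _] := parT x xT xr.
  by move/(IH _ pT); apply: connect_trans; apply/connect1/adjpar.
exists G; split=> //.
- split; first split.
  + by apply/set0Pn; exists r.
  + move=> x y xT yT; apply: connect_trans (toroot x xT) _.
    by rewrite (sym_connect_sym asym); apply: toroot.
  + move=> p szp /andP[cyc un].
    have [x0 x0p] : exists x, x \in p by case: (p) szp => // x; exists x; rewrite mem_head.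
    case: (@arg_maxnP _ x0 (mem p) rk x0p) => x xp mx.
    have [i q ep] := rot_to xp.
    have mq y : y \in x :: q -> rk y <= rk x.
      by rewrite -ep mem_rot; apply: mx.
    have szq : 1 < size q.
      by move: szp; rewrite -(size_rot i) ep.
    have cq : cycle (adj G) (x :: q) by rewrite -ep rot_cycle.
    have uq : uniq (x :: q) by rewrite -ep rot_uniq.
    case: q szq mq cq uq {ep} => [|y [|z q]] //= _ mq.
    rewrite rcons_path => /and3P[axy _ /andP[_ alx]] /and3P[_ ny _].
    have up t : t \in [:: x, y, z & q] -> adj G x t -> t = par x.
      move=> /mq le /adjP[[_ []//]|[tT [tr ex]]].
      by have := rkP t tT tr; rewrite -ex; lia.
    have lq : last z q \in z :: q by apply: mem_last.
    have e1 : y = par x by apply: up => //; rewrite !inE eqxx orbT.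
    have e2 : last z q = par x.
      apply: up; first by rewrite inE [_ \in y :: _]inE lq !orbT.
      by rewrite asym.
    by move: ny; rewrite e1 -e2 lq.
- move=> _ /imsetP[x /setD1P[xr xT] ->].
  have [_] := parT x xT xr; rewrite /red setUC => /andP[_].
  by case: (c _).
- by move=> x xT xr; split; [|rewrite asym]; apply: adjpar.
Qed.

Lemma leaf_nbr (G : graph V) x y z : x \in leaves G -> adj G x y ->
  adj G x z -> y = z.
Proof.
rewrite inE => /andP[_ /cards1P[t /setP E]] xy xz.
by have := E y; have := E z; rewrite !inE xy xz => /esym/eqP-> /esym/eqP->.
Qed.

Lemma blue_partite r (A : 'I_r -> {set V}) m :
    (forall i, #|A i| = m) -> (forall i j, i != j -> [disjoint A i & A j]) ->
    (forall i j x y, i != j -> x \in A i -> y \in A j -> ~~ red x y) ->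
  exists B : graph V, [/\ balanced_complete_partite r B,
    monochromatic c Blue B & verts B = \bigcup_i A i].
Proof.
move=> cA dA nA.
pose between x y := [exists i, exists j, [&& i != j, x \in A i & y \in A j]].
have btw x y : between x y ->
    exists i j, [/\ i != j, x \in A i & y \in A j].
  by case/existsP=> i /existsP[j /and3P[ij xi yj]]; exists i, j.
have neq x y : between x y -> x != y.
  case/btw=> i [j [ij xi yj]]; apply: contraTneq yj => <-.
  by rewrite (disjointFr (dA i j ij) xi).
pose E := [set [set x.1; x.2] | x in [pred x : V * V | between x.1 x.2]].
have wf : [forall f in E, (#|f| == 2) && (f \subset \bigcup_i A i)].
  apply/forall_inP=> _ /imsetP[[x y] /= bxy ->].
  rewrite cards2 (neq _ _ bxy) subUset !sub1set /=.
  have [i [j [_ xi yj]]] := btw _ _ bxy.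
  by apply/andP; split; apply/bigcupP; [exists i|exists j].
exists (Graph wf); split=> //.
- exists m, A; split=> // x y; split.
    case/imsetP=> [[z t] /= /btw[i [j [ij zi tj]]]].
    case/set2_eq=> [[-> ->]|[-> ->]]; first by exists i, j.
    by exists j, i; rewrite eq_sym.
  case=> i [j [ij xi yj]]; apply/imsetP; exists (x, y) => //=.
  by apply/existsP; exists i; apply/existsP; exists j; rewrite ij xi yj.
- move=> _ /imsetP[[x y] /= bxy ->].
  have [i [j [ij xi yj]]] := btw _ _ bxy; have := nA i j x y ij xi yj.
  by rewrite /red (neq _ _ bxy) /=; case: (c _).
Qed.

End Colour.

(** * From balanced slices to the cover *)

Lemma cut_stack (V : finType) (x : V) (ss : seq (seq V)) :
    occ x (flatten ss) = 2 -> (forall s, s \in ss -> occ x s != 2) ->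
  exists t, [/\ 0 < t, t < size ss, x \in flatten (take t ss) &
                x \in flatten (drop t ss)].
Proof.
elim: ss => [|s ss IH] //=; rewrite occ_cat => o2 nos.
have [xs|xs] := boolP (x \in s).
  have xss : x \in flatten ss.
    have := nos s (mem_head _ _); move: xs; rewrite !mem_count; lia.
  exists 1; rewrite /= take0 drop0 cats0; split=> //.
  by case: (ss) xss.
have [||t [t0 lt xt xd]] := IH.
- by move: o2; rewrite occ0.
- by move=> s' s'ss; apply: nos; rewrite inE s'ss orbT.
by exists t.+1; split; rewrite //= mem_cat xt orbT.
Qed.

(** A vertex outside the path [x0 :: p] belongs to the tree if some cut
    separates its two occurrences.  Every leaf is then named by a cut: a leaf
    outside the path lies in the stack of some cut, and two distinct leaves do
    not share a stack, because it is a chain; an end of the path can be a leaf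
    only if the first, or the last, stack is empty. *)
Lemma cover_from_slices (V : finType) (c : colouring V) k m x0 p par w ss :
    1 < k -> uniq (x0 :: p) -> path (childof par) x0 p ->
    (forall x, x != x0 -> red c (par x) x) ->
    (forall x, occ x w = 2 * (x \notin x0 :: p)) ->
    (forall u v, w = u ++ v -> exists a q, [/\ a \in x0 :: p,
       path (childof par) a q & forall x, (x \in q) = (x \in u) && (x \in v)]) ->
    (forall u v x y, w = u ++ v -> occ x u = 2 -> occ y v = 2 ->
       ~~ red c x y) ->
    flatten ss = w -> size ss = k.+1 -> all (exactly m) ss ->
    (forall x, x \in flatten (take 1 ss) -> x \in flatten (drop 1 ss) ->
       par x \in x0 :: p -> par x = x0) ->
    (forall x, x \in flatten (take k ss) -> x \in flatten (drop k ss) ->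
       par x \in x0 :: p -> par x = last x0 p) ->
    (forall x, x \in flatten (take 1 ss) -> x \in flatten (drop 1 ss) ->
       x \in flatten (take k ss) -> x \in flatten (drop k ss) -> False) ->
  exists T B : graph V,
    [/\ tree T /\ monochromatic c Red T, #|leaves T| <= k,
        balanced_complete_partite k.+1 B /\ monochromatic c Blue B,
        [disjoint verts T & verts B]
      & verts T :|: verts B = [set: V]].
Proof.
move=> k1 ub chb redpar occw stk sep fss szs eqs first last' onecut.
pose b := x0 :: p; pose sl (i : 'I_k.+1) := nth [::] ss i.
pose A i := pairs (sl i).
pose U := \bigcup_i A i.
have wcut t : w = flatten (take t ss) ++ flatten (drop t ss).
  by rewrite -fss -flatten_cat cat_take_drop.
have sl_in i : sl i \in ss by apply: mem_nth; rewrite szs.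
have wle x : occ x w <= 2 by rewrite occw; case: (_ \notin _).
have inw x : (x \in w) = (x \notin b) by rewrite mem_count occw; case: (_ \notin _).
have split_sl (i : nat) t : i < t -> i < k.+1 -> exists u v,
    flatten (take t ss) = u ++ nth [::] ss i ++ v.
  move=> it ik; exists (flatten (take i ss)), (flatten (drop i.+1 (take t ss))).
  have lt : i < size (take t ss) by rewrite size_take szs; case: ifP => //; lia.
  rewrite -{1}(cat_take_drop i (take t ss)) flatten_cat (drop_nth [::] lt) /=.
  by rewrite nth_take // take_takel // ltnW.
have split_sr (i : nat) t : t <= i -> i < k.+1 -> exists u v,
    flatten (drop t ss) = u ++ nth [::] ss i ++ v.
  move=> ti ik; exists (flatten (take (i - t) (drop t ss))),
    (flatten (drop (i - t).+1 (drop t ss))).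
  have lt : i - t < size (drop t ss) by rewrite size_drop szs; lia.
  rewrite -{1}(cat_take_drop (i - t) (drop t ss)) flatten_cat (drop_nth [::] lt) /=.
  by rewrite nth_drop subnKC.
have occl (i : 'I_k.+1) t x : i < t -> x \in A i -> occ x (flatten (take t ss)) = 2.
  move=> it; rewrite inE => /eqP o2.
  have [u [v e]] := split_sl i t it (ltn_ord i).
  by have := wle x; rewrite (wcut t) e !occ_cat -/(sl i) o2; lia.
have occr (i : 'I_k.+1) t x : t <= i -> x \in A i -> occ x (flatten (drop t ss)) = 2.
  move=> it; rewrite inE => /eqP o2.
  have [u [v e]] := split_sr i t it (ltn_ord i).
  by have := wle x; rewrite (wcut t) e !occ_cat -/(sl i) o2; lia.
pose stack t := [set x | (x \in flatten (take t ss)) && (x \in flatten (drop t ss))].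
have stackU t x : x \in stack t -> x \notin U.
  rewrite inE => /andP[xl xr]; apply/negP=> /bigcupP[i _ xi].
  have := wle x; rewrite (wcut t) occ_cat; move: xl xr; rewrite !mem_count.
  have [it|ti] := ltnP i t; first by rewrite (occl i t x it xi); lia.
  by rewrite (occr i t x ti xi); lia.
have stackb t x : x \in stack t -> x \notin b.
  by rewrite inE -inw => /andP[xl _]; rewrite (wcut t) mem_cat xl.
have bU x : x \in b -> x \notin U.
  move=> xb; apply/negP=> /bigcupP[i _ /(occr i 0 x (leq0n _))].
  by rewrite drop0 fss occw xb.
have Ustack x : x \notin b -> x \notin U ->
    exists t, [/\ 0 < t, t < k.+1 & x \in stack t].
  move=> xb xU; have [||t [t0 lt xl xr]] := @cut_stack _ x ss.
  - by rewrite fss occw xb.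
  - move=> s sss; apply: contraNneq xU => o2.
    have lt : index s ss < k.+1 by rewrite -szs index_mem.
    by apply/bigcupP; exists (Ordinal lt); rewrite // inE /sl nth_index ?o2.
  by exists t; rewrite -szs inE xl xr.
have schain t : exists a q, [/\ a \in b, path (childof par) a q &
    forall x, (x \in q) = (x \in stack t)].
  have [a [q [ab pq mq]]] := stk _ _ (wcut t).
  by exists a, q; split=> // x; rewrite mq inE.
pose T := ~: U.
have inT x : (x \in T) = (x \notin U) by rewrite inE.
have bT x : x \in b -> x \in T by move/bU; rewrite inT.
have stackT t x : x \in stack t -> x \in T by move/stackU; rewrite inT.
have parT x : x \in T -> x != x0 -> par x \in T.
  rewrite inT => xU xx0; have [xb|xb] := boolP (x \in b).
    apply: bT; apply: chain_par chb _.
    by move: xb; rewrite inE (negPf xx0).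
  have [t [_ _ xt]] := Ustack x xb xU; have [a [q [ab pq mq]]] := schain t.
  have xq : x \in q by rewrite mq.
  have := chain_par pq xq; rewrite inE => /orP[/eqP->|]; first exact: bT.
  by rewrite mq => /stackT.
have reach x : x \in T -> exists n, iter n par x = x0.
  rewrite inT => xU; have [xb|xb] := boolP (x \in b).
    exact: chain_iter chb xb.
  have [t [_ _ xt]] := Ustack x xb xU; have [a [q [ab pq mq]]] := schain t.
  have xq : x \in a :: q by rewrite inE mq xt orbT.
  have [n1 e1] := chain_iter pq xq; have [n2 e2] := chain_iter chb ab.
  by exists (n2 + n1); rewrite iterD e1.
have [rk rkP] := parent_rank parT reach.
have x0T : x0 \in T by apply: bT; rewrite mem_head.
have [G [vG tG mG adjG]] := @parent_tree _ c T x0 par rk x0T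
  (fun x xT xr => conj (parT x xT xr) (redpar x xr)) reach rkP.
have dA (i j : 'I_k.+1) : i != j -> [disjoint A i & A j].
  move=> ij; wlog lt : i j ij / i < j.
    move=> H; have [lt|lt|e] := ltngtP i j; first exact: H.
      by rewrite disjoint_sym; apply: H; rewrite // eq_sym.
    by move: ij; rewrite (val_inj e) eqxx.
  apply/pred0P=> x /=; apply/negP=> /andP[xi xj].
  have := wle x; rewrite (wcut i.+1) occ_cat (occl i i.+1) // (occr j i.+1) //.
have nA (i j : 'I_k.+1) x y : i != j -> x \in A i -> y \in A j -> ~~ red c x y.
  move=> ij; wlog lt : i j x y ij / i < j.
    move=> H; have [lt|lt|e] := ltngtP i j; first exact: H.
      by move=> xi yj; rewrite red_sym; apply: (H j i); rewrite // eq_sym.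
    by move: ij; rewrite (val_inj e) eqxx.
  by move=> xi yj; apply: (sep _ _ _ _ (wcut i.+1)); [apply: occl xi|apply: occr yj].
have cA i : #|A i| = m by apply/eqP; move/allP: eqs; apply.
have [B [bB mB vB]] := blue_partite cA dA nA.
have vB' : verts B = ~: T by rewrite vB setCK.
exists G, B; split=> //; last 2 first.
- by rewrite vG vB' disjoints_subset setCK.
- by rewrite vG vB' setUCr.
have adjpar x : x \in T -> x != x0 -> adj G x (par x).
  by move=> xT xr; have [] := adjG x xT xr.
have adjchild x y : y \in T -> y != x0 -> par y = x -> adj G x y.
  by move=> yT yr <-; have [_] := adjG y yT yr.
have two_nbrs x z : x \in leaves G -> x != x0 -> z \in T -> z != x0 ->
    par z = x -> False.
  move=> lx xx0 zT zx0 pz.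
  have xT : x \in T by move: lx; rewrite inE vG => /andP[].
  have e := leaf_nbr lx (adjpar x xT xx0) (adjchild x z zT zx0 pz).
  by have := rkP x xT xx0; have := rkP z zT zx0; rewrite pz e; lia.
have stackx0 t x : x \in stack t -> x != x0.
  by move/stackb; apply: contraNneq => ->; rewrite mem_head.
(* The bottom of a nonempty stack hangs from the path. *)
have sroot t x : x \in stack t -> exists2 r, r \in stack t & par r \in b.
  have [a [q [ab pq mq]]] := schain t; rewrite -mq.
  case: (q) pq mq => // r q' /= /andP[/eqP pr _] mq _.
  by exists r; rewrite ?pr // -mq mem_head.
have leafstack t x y : x \in leaves G -> y \in leaves G -> x \in stack t ->
    y \in stack t -> x = y.
  move=> lx ly xt yt; apply/eqP/negPn/negP=> xy.
  have [a [q [ab pq mq]]] := schain t; rewrite -!mq in xt yt.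
  have [z] := chain_child pq xt yt xy; rewrite mq => zt.
  have zT := stackT t z zt; have z0 := stackx0 t z zt.
  rewrite !mq in xt yt.
  have xx0 := stackx0 t x xt; have yx0 := stackx0 t y yt.
  by case=> pz; [apply: (two_nbrs x z)|apply: (two_nbrs y z)].
pose rep (t : 'I_k) := odflt (if t == 0 :> nat then x0 else last x0 p)
  [pick y in stack t.+1 | y \in leaves G].
suff sub : leaves G \subset [set rep t | t in 'I_k].
  by apply: leq_trans (subset_leq_card sub) (leq_trans (leq_imset_card _ _) _);
     rewrite card_ord.
apply/subsetP=> x lx; have xT : x \in T by move: lx; rewrite inE vG => /andP[].
have [xb|xb] := boolP (x \in b); last first.
  have xU : x \notin U by rewrite -inT.
  have [t [t0 tk xt]] := Ustack x xb xU; case: t t0 tk xt => // t _ tk xt.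
  apply/imsetP; exists (Ordinal (tk : t < k)) => //; rewrite /rep /=.
  case: pickP => [y /andP[yt ly]|/(_ x)]; last by rewrite xt lx.
  exact: leafstack yt.
have empty_rep (t : 'I_k) : stack t.+1 = set0 ->
    rep t = if t == 0 :> nat then x0 else last x0 p.
  by move=> e; rewrite /rep; case: pickP => //= y; rewrite e inE.
have k0 : 0 < k by lia.
pose tf := Ordinal k0.
have kl : k.-1 < k by lia.
pose tl := Ordinal kl.
have xlast : x = x0 \/ x = last x0 p.
  have [->|xx0] := eqVneq x x0; first by left.
  have [->|xl] := eqVneq x (last x0 p); first by right.
  have [z zp pz] := chain_next chb xb xl.
  case: (two_nbrs x z lx xx0 _ _ pz); first by apply: bT; rewrite inE zp orbT.
  by apply: contraNneq xx0 => ez; rewrite -ez; move: ub; rewrite /= -ez zp.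
have no_stack t r : r \in stack t -> par r \in b -> par r = x -> p != [::] ->
    False.
  move=> rt rb pr pn.
  have rT := stackT t r rt; have r0 := stackx0 t r rt.
  have [xx0|xx0] := eqVneq x x0; last exact: (two_nbrs x r).
  have [y yp py] : exists2 y, y \in p & par y = x0.
    apply: chain_next chb (mem_head _ _) _; apply: contraNneq pn => e.
    by case: (p) ub e => //= y q /andP[nx _] e; move: nx; rewrite e mem_last.
  have yb : y \in b by rewrite inE yp orbT.
  have yx0 : y != x0.
    by apply: contraTneq ub => <-; rewrite /= yp.
  rewrite xx0 in lx pr.
  have e := leaf_nbr lx (adjchild _ _ (bT y yb) yx0 py) (adjchild _ _ rT r0 pr).
  by have := stackb t r rt; rewrite -e yb.
have first_empty : (forall r, r \in stack 1 -> False) -> x = x0 ->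
    x \in [set rep t | t in 'I_k].
  move=> e ->; apply/imsetP; exists tf => //; rewrite empty_rep //.
  by apply/setP=> r; rewrite in_set0; apply/negP=> /e.
have last_empty : (forall r, r \in stack k -> False) -> x = last x0 p ->
    x \in [set rep t | t in 'I_k].
  move=> e ->; apply/imsetP; exists tl => //; rewrite empty_rep /= ?prednK //.
    by case: eqP => // e1; lia.
  by apply/setP=> r; rewrite in_set0; apply/negP=> /e.
have par1 r : r \in stack 1 -> par r \in b -> par r = x0.
  by rewrite inE => /andP[]; apply: first.
have park r : r \in stack k -> par r \in b -> par r = last x0 p.
  by rewrite inE => /andP[]; apply: last'.
have [p0|pn] := eqVneq p [::]; last first.
  case: xlast => ex; [apply: first_empty|apply: last_empty] => // r /sroot[r' r't pb].
    by apply: (no_stack 1 r') => //; rewrite ex; apply: par1.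
  by apply: (no_stack k r') => //; rewrite ex; apply: park.
have xx0 : x = x0 by case: xlast; rewrite // p0.
have [s1|/set0Pn[r1 /sroot[r r1s pr]]] := eqVneq (stack 1) set0.
  by apply: first_empty => // r; rewrite s1 inE.
apply: last_empty; last by rewrite p0.
move=> r2 /sroot[r' rks pr']; move: lx; rewrite xx0 => lx.
have a1 := adjchild x0 r (stackT 1 r r1s) (stackx0 1 r r1s) (par1 r r1s pr).
have := park r' rks pr'; rewrite p0 /= => prr'.
have a2 := adjchild x0 r' (stackT k r' rks) (stackx0 k r' rks) prr'.
have e := leaf_nbr lx a1 a2.
by move: r1s rks; rewrite -e !inE => /andP[h1 h2] /andP[h3 h4]; apply: (onecut r).
Qed.

(** * A red path together with the pieces outside it *)

Lemma path_parent (V : eqType) (R : rel V) x0 p : uniq (x0 :: p) ->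
    path R x0 p ->
  exists pb : V -> V, path (fun y x => pb x == y) x0 p /\
    forall x, x \in p -> R (pb x) x.
Proof.
move=> /= /andP[_ up] /(pathP x0) H.
exists (fun y => nth x0 (x0 :: p) (index y p)); split.
  by apply/(pathP x0) => i lt; rewrite index_uniq.
move=> x xp; have lt : index x p < size p by rewrite index_mem.
by have := H _ lt; rewrite (nth_index _ xp).
Qed.

Lemma flatten_map_cut (T U : Type) (f : T -> seq U) (l : seq T) u v :
    flatten (map f l) = u ++ v ->
  (l = [::]) \/ exists l1 K l2 s1 s2, [/\ l = l1 ++ K :: l2, f K = s1 ++ s2,
     u = flatten (map f l1) ++ s1 & v = s2 ++ flatten (map f l2)].
Proof.
elim: l u => [|K l IH] u /=; first by left.
move=> H; right; case/cat_split: H => [[s2 [eK ev]]|[t [eu et]]].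
  by exists [::], K, l, u, s2.
have [l0|[l1 [L [l2 [s1 [s2 [el eL et' ev]]]]]]] := IH t et.
  move: et eu; rewrite l0 /= => /esym/nilP; rewrite /nilp size_cat addn_eq0.
  case/andP=> /nilP-> /nilP-> ->; exists [::], K, [::], (f K), [::].
  by rewrite !cats0.
exists (K :: l1), L, l2, s1, s2; rewrite /= el eu et' catA; split=> //.
Qed.

Section Base.
Variables (V : finType) (c : colouring V).
Implicit Types (x y : V) (K L : {set V}) (cs : seq {set V}).

Definition mass cs := sumn (map (fun K => #|K|) cs).

Definition covered k := exists T B : graph V,
    [/\ tree T /\ monochromatic c Red T, #|leaves T| <= k,
        balanced_complete_partite k.+1 B /\ monochromatic c Blue B,
        [disjoint verts T & verts B]
      & verts T :|: verts B = [set: V]].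

Definition multi x cs := count (fun K => x \in K) cs.

Lemma multi_gt0 x cs K : K \in cs -> x \in K -> 0 < multi x cs.
Proof. by move=> Kcs xK; rewrite -has_count; apply/hasP; exists K. Qed.

Lemma multi_uniq x cs K L : multi x cs <= 1 -> K \in cs -> L \in cs ->
  x \in K -> x \in L -> K = L.
Proof.
move=> m1 Kcs Lcs xK xL; apply/eqP/negPn/negP=> KL.
have := perm_to_rem Kcs => pe.
have Lr : L \in rem K cs.
  by move: Lcs; rewrite (perm_mem pe) inE eq_sym (negPf KL).
move: m1; rewrite /multi (permP pe) /= xK.
by have := multi_gt0 Lr xL; rewrite /multi; lia.
Qed.

(** A red path and pieces that partition the other vertices, connected
    and pairwise without red edges.  The pieces need not be the components
    of a fixed graph: they are merged when the path is shortened. *)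
Record system x0 p cs : Prop := System {
  sys_uniq : uniq (x0 :: p);
  sys_path : path (red c) x0 p;
  sys_part : forall x, multi x cs = (x \notin x0 :: p);
  sys_conn : forall K r, K \in cs -> r \in K -> connected_from (red c) r K;
  sys_att : forall K, K \in cs -> exists a r,
    [/\ a \in x0 :: p, r \in K & red c a r];
  sys_sep : forall K L x y, K \in cs -> L \in cs -> x \in K -> y \in L ->
    red c x y -> K = L
}.

(** Attach the pieces of [As] to the first vertex of the path, those of [Zs]
    to the last one, and the others anywhere.  The words of [As] form one
    block, as do those of [Zs]; a stack in such a block hangs from the
    respective end. *)
Lemma cover_from_system k d x0 p As Zs Fs :
    1 < k -> system x0 p (As ++ Zs ++ Fs) ->
    (forall K, K \in As -> exists2 r, r \in K & red c x0 r) ->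
    (forall K, K \in Zs -> exists2 r, r \in K & red c (last x0 p) r) ->
    (forall K, K \in Fs -> #|K| <= d) ->
    d <= mass As < 2 * d -> d <= mass Zs < 2 * d -> d <= mass Fs ->
  covered k.
Proof.
move=> k1 S attA attZ leF tA tZ tF; set cs := As ++ _ in S.
pose b := x0 :: p.
have m1 x : multi x cs <= 1 by rewrite (sys_part S); case: (_ \notin _).
have notb K x : K \in cs -> x \in K -> x \notin b.
  by move=> Kcs xK; have := multi_gt0 Kcs xK; rewrite (sys_part S); case: (_ \notin _).
have inA K : K \in As -> K \in cs by rewrite mem_cat => ->.
have inZ K : K \in Zs -> K \in cs by rewrite !mem_cat => ->; rewrite orbT.
have inF K : K \in Fs -> K \in cs by rewrite !mem_cat => ->; rewrite !orbT.
have AZ K L x : K \in As -> L \in Zs -> x \in K -> x \in L -> False.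
  move=> KA LZ xK xL; have := m1 x; rewrite /multi !count_cat.
  have := multi_gt0 KA xK; have := multi_gt0 LZ xL; rewrite /multi; lia.
pose good K (t : V * seq V * {ffun V -> V}) :=
  [/\ exists r, traversal (red c) t.1.1 r K t.1.2 t.2, t.1.1 \in b,
      K \in As -> t.1.1 = x0 & K \in Zs -> t.1.1 = last x0 p].
have /fin_all_exists[tr trP] : forall K, exists t, K \in cs -> good K t.
  move=> K; have [Kcs|Kcs] := boolP (K \in cs); last by exists (x0, [::], [ffun x => x]).
  suff [a [r [ab rK ar aA aZ]]] : exists a r, [/\ a \in b, r \in K, red c a r,
      K \in As -> a = x0 & K \in Zs -> a = last x0 p].
    have [s [par T]] := traversal_exists (sys_conn S Kcs rK) ar.
    exists (a, s, finfun par) => _; split=> //=; exists r.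
    have fp : finfun par =1 par by move=> x; rewrite ffunE.
    case: T => h1 h2 h3 h4 h5 h6 h7; split=> //.
    - move=> u v /h2[q [pq mq]]; exists q; split=> //.
      by rewrite (eq_in_path_child (par2 := par)).
    - by move=> x xK; rewrite fp; apply: h4.
    - by move=> x xK; rewrite fp; apply: h5.
    - by rewrite fp.
  have [KA|KA] := boolP (K \in As).
    have [r rK ar] := attA K KA; exists x0, r; split=> //; first exact: mem_head.
    by move=> KZ; case: (AZ K K r).
  have [KZ|KZ] := boolP (K \in Zs).
    have [r rK ar] := attZ K KZ; exists (last x0 p), r; split=> //.
    exact: mem_last.
  by have [a [r [ab rK ar]]] := sys_att S Kcs; exists a, r.
pose wd K := (tr K).1.2; pose att K := (tr K).1.1; pose pr K := (tr K).2.
have [pb [chb redb]] := path_parent (sys_uniq S) (sys_path S).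
pose Kof x := nth set0 cs (find (fun K => x \in K) cs).
pose par x := if x \in b then pb x else pr (Kof x) x.
have KofE K x : K \in cs -> x \in K -> Kof x = K.
  move=> Kcs xK; have h : has (fun K => x \in K) cs by apply/hasP; exists K.
  have := nth_find set0 h; rewrite -/(Kof x) => xKo.
  by apply: (multi_uniq (m1 x)) xKo xK => //; apply: mem_nth; rewrite -has_find.
have parE K x : K \in cs -> x \in K -> par x = pr K x.
  by move=> Kcs xK; rewrite /par (negPf (notb K x Kcs xK)) (KofE K x).
have trv K : K \in cs -> exists r, traversal (red c) (att K) r K (wd K) (pr K).
  by case/trP.
have mwd K x : K \in cs -> (x \in wd K) = (x \in K).
  by case/trv=> r T; apply: trav_mem T.
have owd K x : K \in cs -> occ x (wd K) = 2 * (x \in K).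
  by case/trv=> r T; exact: (trav_occ T x).
have occcs l x : {subset l <= cs} ->
    occ x (flatten (map wd l)) = 2 * multi x l.
  elim: l => [|K l IH] sub //=; rewrite occ_cat IH ?owd ?sub ?mem_head //.
    by rewrite mulnDr.
  by move=> L Ll; apply: sub; rewrite inE Ll orbT.
have cwd K : K \in cs -> cnt (wd K) = #|K|.
  by move=> Kcs; apply: eq_card => x; rewrite !inE owd //; case: (x \in K).
have clos K : K \in cs -> paired (wd K).
  by move=> Kcs x; rewrite mwd // owd // => ->.
have mcs l x : {subset l <= cs} -> (x \in flatten (map wd l)) = (0 < multi x l).
  by move=> sub; rewrite mem_count occcs // muln_gt0.
have cntcs l : {subset l <= cs} -> (forall x, multi x l <= 1) ->
    cnt (flatten (map wd l)) = mass l.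
  elim: l => [|K l IH] sub mu; first by rewrite cnt_nil.
  have Kcs : K \in cs by apply: sub; rewrite mem_head.
  have sub' : {subset l <= cs} by move=> L Ll; apply: sub; rewrite inE Ll orbT.
  rewrite /= cnt_cat ?cwd ?IH // => x; first by have := mu x; rewrite /multi /=; lia.
  rewrite mwd // mcs // => xK; have := mu x; rewrite /multi /= xK; lia.
pose A := flatten (map wd As); pose Z := flatten (map wd Zs).
have sA : {subset As <= cs} by move=> K; apply: inA.
have sZ : {subset Zs <= cs} by move=> K; apply: inZ.
have sF : {subset Fs <= cs} by move=> K; apply: inF.
have m3 x : multi x As + (multi x Zs + multi x Fs) <= 1.
  by have := m1 x; rewrite /multi !count_cat.
have cA : cnt A = mass As by apply: cntcs => // x; have := m3 x; lia.
have cZ : cnt Z = mass Zs by apply: cntcs => // x; have := m3 x; lia.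
have cF : cnt (flatten (map wd Fs)) = mass Fs.
  by apply: cntcs => // x; have := m3 x; lia.
have twAZ : twice (flatten (A :: Z :: map wd Fs)).
  by move=> x; rewrite /= !occ_cat !occcs //; have := m3 x; lia.
have clAZ f : f \in A :: Z :: map wd Fs -> paired f.
  rewrite !inE => /or3P[/eqP->|/eqP->|/mapP[K KF ->]] x; last exact/clos/inF.
    by rewrite mcs // occcs //; have := m3 x; lia.
  by rewrite mcs // occcs //; have := m3 x; lia.
have szF f : f \in map wd Fs -> 0 < cnt f <= d.
  move=> /mapP[K KF ->]; rewrite cwd ?leF ?inF // andbT card_gt0.
  by have [a [r [_ rK _]]] := sys_att S (inF K KF); apply/set0Pn; exists r.
rewrite -cA in tA; rewrite -cZ in tZ; rewrite -cF in tF.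
have [ws [ss [m [pws fss szs eqs [cut1 cutk]]]]] :=
  balanced_cuts k1 twAZ clAZ szF tA tZ tF.
pose f l := flatten (map wd l).
pose Ls := As :: Zs :: map (fun K => [:: K]) Fs.
have eLs : A :: Z :: map wd Fs = map f Ls.
  rewrite /= -map_comp; congr [:: _, _ & _]; apply: eq_map => K /=.
  by rewrite /f /= cats0.
have [cs' pcs' ews] : exists2 cs', perm_eq cs' cs & flatten ws = f cs'.
  move: pws; rewrite eLs => /(perm_iotaP [::])[Is pI eI].
  exists (flatten (map (nth [::] Ls) Is)).
    have -> : cs = flatten (map (nth [::] Ls) (iota 0 (size Ls))).
      rewrite map_nth_iota0 // take_size /cs /=; congr (_ ++ (_ ++ _)).
      by elim: (Fs) => //= K l <-.
    by apply/perm_flatten/perm_map; rewrite size_map in pI.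
  have fE t : nth [::] (map f Ls) t = f (nth [::] Ls t).
    have [lt|ge] := ltnP t (size Ls); first by rewrite (nth_map [::]).
    by rewrite !nth_default ?size_map.
  rewrite eI (eq_map fE) /f map_flatten flatten_flatten; congr flatten.
  by rewrite -!map_comp.
have mem' K : (K \in cs') = (K \in cs) by exact: (perm_mem pcs' K).
have sub' : {subset cs' <= cs} by move=> K; rewrite mem'.
have m1' x : multi x cs' <= 1 by rewrite /multi (permP pcs'); apply: m1.
have occw x : occ x (flatten ws) = 2 * (x \notin b).
  by rewrite ews occcs // /multi (permP pcs') -/(multi x cs) (sys_part S).
have inb x : x \in flatten ws -> exists2 K, K \in cs' & x \in K.
  rewrite ews /f mcs // -has_count => /hasP[K]; by exists K.
have memA x : x \in A -> exists2 K, K \in As & x \in K.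
  by rewrite /A mcs // -has_count => /hasP[K]; exists K.
have memZ x : x \in Z -> exists2 K, K \in Zs & x \in K.
  by rewrite /Z mcs // -has_count => /hasP[K]; exists K.
have parK K x : K \in cs -> x \in K -> par x \in b -> par x = att K.
  move=> Kcs xK; rewrite (parE K) //; have [r T] := trv K Kcs.
  by case: (trav_par T xK) => // pK; rewrite (negPf (notb _ _ Kcs pK)).
have cutK u v : f cs' = u ++ v -> cs' = [::] \/ exists K s1 s2,
    [/\ K \in cs', wd K = s1 ++ s2 &
     (forall x, x \in K -> occ x u = occ x s1 /\ occ x v = occ x s2) /\
     (forall L, L \in cs' -> L != K -> {in L, forall x, x \notin u} \/
                                       {in L, forall x, x \notin v})].
  case/flatten_map_cut=> [|[l1 [K [l2 [s1 [s2 [el eK eu ev]]]]]]].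
    by left.
  right.
  have ml x : multi x l1 + (x \in K) + multi x l2 <= 1.
    by have := m1' x; rewrite /multi el count_cat /= addnA.
  have s1cs : {subset l1 <= cs} by move=> L Ll; apply: sub'; rewrite el mem_cat Ll.
  have s2cs : {subset l2 <= cs}.
    by move=> L Ll; apply: sub'; rewrite el mem_cat inE Ll !orbT.
  have Kcs' : K \in cs' by rewrite el mem_cat mem_head orbT.
  exists K, s1, s2; split=> //; split=> [x xK|L Lcs LK].
    have := ml x; rewrite xK eu ev !occ_cat !occcs //; lia.
  have notK x : x \in L -> (x \notin s1) && (x \notin s2).
    move=> xL; have xK : x \notin K.
      by apply: contraNN LK => xK; apply/eqP; exact: (multi_uniq (m1' x) Lcs Kcs' xL xK).
    by rewrite -negb_or -mem_cat -eK mwd ?sub'.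
  move: (Lcs); rewrite el mem_cat inE (negPf LK) /= => /orP[Ll|Ll].
    right=> x xL; have /andP[_ x2] := notK x xL.
    rewrite ev mem_cat (negPf x2) mcs //.
    by have := ml x; have := multi_gt0 Ll xL; lia.
  left=> x xL; have /andP[x1 _] := notK x xL.
  rewrite eu mem_cat (negPf x1) orbF mcs //.
  by have := ml x; have := multi_gt0 Ll xL; lia.
apply: (@cover_from_slices _ c k m x0 p par (flatten ws) ss) => //.
- exact: sys_uniq S.
- rewrite (eq_in_path_child (par2 := pb)) // => x xp.
  by rewrite /par /b inE xp orbT.
- move=> x xx0; have [xb|xb] := boolP (x \in b).
    by rewrite /par xb; apply: redb; move: xb; rewrite inE (negPf xx0).
  have : 0 < multi x cs by rewrite (sys_part S) xb.
  rewrite -has_count => /hasP[K Kcs xK]; rewrite (parE K) //.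
  by have [r T] := trv K Kcs; apply: (trav_red T).
- move=> u v ew; have := cutK u v; rewrite -ews => /(_ ew).
  have inu x : x \in u -> exists2 K, K \in cs' & x \in K.
    by move=> xu; apply: inb; rewrite ew mem_cat xu.
  case=> [e0|[K [s1 [s2 [Kcs' eK [occK other]]]]]].
    exists x0, [::]; rewrite mem_head; split=> // x; rewrite in_nil.
    by apply/esym/negbTE/negP=> /andP[/inu[K]]; rewrite e0.
  have Kcs := sub' K Kcs'; have [r T] := trv K Kcs.
  have [q [pq mq]] := trav_stack T eK.
  have qK x : x \in q -> x \in K.
    by rewrite mq -(mwd K) // eK mem_cat => /andP[->].
  exists (att K), q; split; first by case: (trP K Kcs).
    rewrite (eq_in_path_child (par2 := pr K)) // => x /qK; exact: parE.
  move=> x; have [xK|xK] := boolP (x \in K).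
    by rewrite mq !mem_count; have [-> ->] := occK x xK.
  have -> : x \in q = false by apply: contraNF xK => /qK.
  apply/esym/negbTE/negP=> /andP[xu xv]; have [L Lcs xL] := inu x xu.
  have LK : L != K by apply: contraNneq xK => <-.
  by have [/(_ x xL)|/(_ x xL)] := other L Lcs LK; rewrite ?xu ?xv.
- move=> u v x y ew hx hy; apply/negP=> rxy.
  have xu : x \in u by rewrite mem_count hx.
  have yv : y \in v by rewrite mem_count hy.
  have [L Lcs xL] : exists2 L, L \in cs' & x \in L.
    by apply: inb; rewrite ew mem_cat xu.
  have [L' Lcs' yL] : exists2 L, L \in cs' & y \in L.
    by apply: inb; rewrite ew mem_cat yv orbT.
  have eL := sys_sep S (sub' _ Lcs) (sub' _ Lcs') xL yL rxy; subst L'.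
  have := cutK u v; rewrite -ews => /(_ ew).
  case=> [e0|[K [s1 [s2 [Kcs' eK [occK other]]]]]]; first by rewrite e0 in Lcs.
  have [LK|LK] := eqVneq L K; last first.
    by have [/(_ x xL)|/(_ y yL)] := other L Lcs LK; rewrite ?xu ?yv.
  subst L; have [r T] := trv K (sub' _ Kcs').
  have := trav_sep T (x := x) (y := y) eK; rewrite rxy.
  have [<- _] := occK x xL; have [_ <-] := occK y yL.
  by move=> /(_ hx hy).
- move=> x xt xd; have [K KA xK] := memA x (cut1 x xt xd) => pb'.
  by rewrite (parK K) ?inA //; have [_ _ aA _] := trP K (inA K KA); apply: aA.
- move=> x xt xd; have [K KZ xK] := memZ x (cutk x xt xd) => pb'.
  by rewrite (parK K) ?inZ //; have [_ _ _ aZ] := trP K (inZ K KZ); apply: aZ.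
- move=> x xt xd xt' xd'; have [K KA xK] := memA x (cut1 x xt xd).
  have [L LZ xL] := memZ x (cutk x xt' xd').
  exact: AZ KA LZ xK xL.
Qed.
End Base.

Section Systems.
Variables (V : finType) (c : colouring V).
Implicit Types (x y : V) (K L S : {set V}) (cs : seq {set V}).
Local Notation red := (red c).

Definition meets x K := [exists r in K, red x r].

Definition union_of cs : {set V} := [set x | 0 < multi x cs].

Lemma multi_cat x cs1 cs2 : multi x (cs1 ++ cs2) = multi x cs1 + multi x cs2.
Proof. exact: count_cat. Qed.

Lemma mem_union_of x cs : (x \in union_of cs) = has (fun K => x \in K) cs.
Proof. by rewrite inE has_count. Qed.

Lemma card_union_of cs : (forall x, multi x cs <= 1) -> #|union_of cs| = mass cs.
Proof.
elim: cs => [|K cs IH] H.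
  by apply/eqP; rewrite cards_eq0; apply/eqP/setP=> x; rewrite !inE.
have H' x : multi x cs <= 1 by have := H x; rewrite /multi /=; lia.
rewrite /mass /= -/(mass cs) -IH // -cardsUI.
have -> : K :&: union_of cs = set0.
  by apply/setP=> x; rewrite !inE; have := H x; rewrite /multi /=; case: (x \in K) => //=; lia.
rewrite cards0 addn0; apply: eq_card => x; rewrite !inE /multi /=.
by case: (x \in K) => //=; lia.
Qed.

Lemma system_perm x0 p cs cs' : perm_eq cs cs' -> system c x0 p cs ->
  system c x0 p cs'.
Proof.
move=> pe [h1 h2 h3 h4 h5 h6].
have m K : K \in cs' -> K \in cs by rewrite (perm_mem pe).
split=> //.
- by move=> x; rewrite /multi -(permP pe); apply: h3.
- by move=> K r /m; apply: h4.
- by move=> K /m; apply: h5.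
- by move=> K L x y /m Kcs /m; apply: h6.
Qed.

Lemma system_rev x0 p x1 q cs : rev (x0 :: p) = x1 :: q -> system c x0 p cs ->
  system c x1 q cs.
Proof.
move=> er [h1 h2 h3 h4 h5 h6].
have mem x : (x \in x1 :: q) = (x \in x0 :: p) by rewrite -er mem_rev.
split=> //.
- by rewrite -er rev_uniq.
- have : sorted red (rev (x0 :: p)); last by rewrite er.
  rewrite rev_sorted /= (eq_path (e' := red)) // => x y.
  exact: red_sym.
- by move=> x; rewrite mem.
- by move=> K /h5[a [r [ab rK ar]]]; exists a, r; rewrite mem.
Qed.

(** The vertex [x0] leaves the path and joins all pieces that it meets into
    one. *)
Lemma drop_head x0 x1 p Ks Rs :
    system c x0 (x1 :: p) (Ks ++ Rs) ->
    (forall K, K \in Ks -> meets x0 K) -> (forall K, K \in Rs -> ~~ meets x0 K) ->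
  system c x1 p ((x0 |: union_of Ks) :: Rs).
Proof.
move=> [/= /andP[x0p up] /andP[r01 pp] part conn att sep] mK mR.
pose D := x0 |: union_of Ks.
have DP x : x \in D -> x = x0 \/ exists2 K, K \in Ks & x \in K.
  rewrite in_setU1 mem_union_of => /orP[/eqP|/hasP[K Ks' xK]]; first by left.
  by right; exists K.
have KD K x : K \in Ks -> x \in K -> x \in D.
  by move=> KK xK; rewrite in_setU1 mem_union_of; apply/orP; right; apply/hasP; exists K.
have inK K : K \in Ks -> K \in Ks ++ Rs by rewrite mem_cat => ->.
have inR K : K \in Rs -> K \in Ks ++ Rs by rewrite mem_cat => ->; rewrite orbT.
have sepD L x y : L \in Rs -> x \in D -> y \in L -> red x y -> False.
  move=> LR /DP[->|[K KK xK]] yL rxy.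
    by have := mR L LR; case/negP; apply/exists_inP; exists y.
  have eL := sep K L x y (inK K KK) (inR L LR) xK yL rxy.
  by have := mR L LR; rewrite -eL mK.
split=> //.
- move=> x; have := part x; rewrite multi_cat /multi /= -/(multi x Rs) -/(multi x Ks).
  rewrite in_setU1 [x \in union_of _]inE [x \in x0 :: _]inE.
  case: eqVneq => [->|_] /=; last by case: (_ \notin _); lia.
  by rewrite x0p; lia.
- move=> K r; rewrite inE => /orP[/eqP->|KR]; last by apply: conn; apply: inR.
  move=> rD; split=> // X rX clX.
  have KX L y : L \in Ks -> y \in L -> y \in X -> L \subset X.
    move=> LK yL yX; have [_] := conn L y (inK L LK) yL.
    apply=> // u v uX uL vL ruv.
    by apply: clX ruv; rewrite // (KD L).
  have x0D : x0 \in D by rewrite setU11.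
  have x0X : x0 \in X.
    have [<-//|[L LK rL]] := DP r rD.
    have /exists_inP[y yL ry] := mK L LK.
    have yX : y \in X by move: y yL {ry}; apply/subsetP/(KX L r).
    by apply: (clX y x0) => //; [exact: (KD L)|rewrite red_sym].
  apply/subsetP=> y /DP[->//|[L LK yL]].
  have /exists_inP[z zL rz] := mK L LK.
  have zX : z \in X by apply: (clX x0 z) => //; exact: (KD L).
  by move: y yL; apply/subsetP/(KX L z).
- move=> K; rewrite inE => /orP[/eqP->|KR].
    by exists x1, x0; rewrite mem_head setU11 red_sym.
  have [a [r [ab rK ar]]] := att K (inR K KR).
  exists a, r; split=> //; move: ab; rewrite inE => /orP[/eqP ea|//].
  by have := mR K KR; case/negP; apply/exists_inP; exists r; rewrite // -ea.
- move=> K L x y; rewrite !inE => /orP[/eqP->|KR] /orP[/eqP->|LR] // xK yL rxy.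
  + by case: (sepD L x y).
  + by case: (sepD K y x) => //; rewrite red_sym.
  + exact: sep (inR K KR) (inR L LR) xK yL rxy.
Qed.

(** Each piece adds less than [d]. *)
Lemma prefix_of_mass d cs : 0 < d -> (forall K, K \in cs -> #|K| < d) -> d <= mass cs ->
  exists cs1 cs2, cs = cs1 ++ cs2 /\ d <= mass cs1 < 2 * d.
Proof.
move=> d0 H; elim/last_ind: cs H => [|cs K IH] H.
  by rewrite leqNgt d0.
have HK := H K; rewrite mem_rcons mem_head in HK; have {}HK := HK isT.
have H' L : L \in cs -> #|L| < d.
  by move=> Lcs; apply: H; rewrite mem_rcons inE Lcs orbT.
have [/(IH H')[cs1 [cs2 [-> h]]] _|lt] := leqP d (mass cs).
  by exists cs1, (rcons cs2 K); rewrite rcons_cat.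
have e : mass (rcons cs K) = mass cs + #|K|.
  by rewrite /mass map_rcons sumn_rcons.
by move=> le; exists (rcons cs K), [::]; rewrite cats0; split=> //; lia.
Qed.

(** If the pieces that meet [x0] have at least [d] vertices, then some of
    them make up [As].  Otherwise they have [d - 1]; then [x0] leaves the path
    and completes them to a single piece with [d] vertices. *)
Lemma expose_head d x0 y q Ks Rs :
    0 < d -> system c x0 (y :: q) (Ks ++ Rs) ->
    (forall K, K \in Ks -> meets x0 K) -> (forall K, K \in Rs -> ~~ meets x0 K) ->
    (forall K, K \in Ks -> #|K| < d) -> d <= (mass Ks).+1 ->
  exists z0 q' As Fs, [/\ system c z0 q' (As ++ Fs ++ Rs),
    (forall K, K \in As -> meets z0 K) /\ (forall K, K \in Fs -> #|K| <= d),
    d <= mass As < 2 * d,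
    forall K, K \in As ++ Fs -> K \subset x0 |: union_of Ks &
    z0 :: q' = x0 :: y :: q \/ z0 :: q' = y :: q].
Proof.
move=> d0 S mK mR ltK tK; have [le|gt] := leqP d (mass Ks).
  have [As [Fs [eK tA]]] := prefix_of_mass d0 ltK le.
  exists x0, (y :: q), As, Fs; split=> //; last by left.
  - by rewrite catA -eK.
  - split=> K KK; first by apply: mK; rewrite eK mem_cat KK.
    by apply/ltnW/ltK; rewrite eK mem_cat KK orbT.
  - move=> K; rewrite -eK => KK; apply/subsetP=> x xK; rewrite in_setU1 mem_union_of.
    by apply/orP; right; apply/hasP; exists K.
exists y, q, [:: x0 |: union_of Ks], [::]; split; last by right.
- exact: drop_head.
- split=> // K; rewrite inE => /eqP->; apply/exists_inP; exists x0; rewrite ?setU11 //.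
  by have /= /andP[r01 _] := sys_path S; rewrite red_sym.
- have m1 x : multi x Ks <= 1.
    by have := sys_part S x; rewrite multi_cat; case: (_ \notin _) => /=; lia.
  have x0K : x0 \notin union_of Ks.
    by rewrite inE; have := sys_part S x0; rewrite multi_cat mem_head /=; lia.
  by rewrite /mass /= cardsU1 x0K card_union_of //; lia.
- by move=> K; rewrite cats0 inE => /eqP->.
Qed.

End Systems.

(** * Components outside a path, and how they change with it *)

Section Extremal.
Variables (V : finType) (c : colouring V).
Implicit Types (x y z : V) (K L S D : {set V}).
Local Notation red := (red c).

Definition off S : rel V := fun x y => [&& red x y, x \notin S & y \notin S].
Definition component S x : {set V} := [set y | connect (off S) x y].

Lemma off_sym S : symmetric (off S).
Proof. by move=> x y; rewrite /off red_sym; congr (_ && _); apply: andbC. Qed.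

Lemma comp_refl S x : x \in component S x.
Proof. by rewrite inE connect0. Qed.

Lemma comp_eq S x y : y \in component S x -> component S y = component S x.
Proof.
rewrite inE => xy; apply/setP=> z; rewrite !inE.
by rewrite (same_connect (sym_connect_sym (off_sym S)) xy).
Qed.

Lemma comp_step S x y z : y \in component S x -> off S y z -> z \in component S x.
Proof. by rewrite !inE => xy yz; apply: connect_trans xy (connect1 yz). Qed.

Lemma comp_off S x y : x \notin S -> y \in component S x -> y \notin S.
Proof.
move=> xS; rewrite inE => xy.
by apply: (@connect_inv _ (off S) (fun z => z \notin S)) xy xS => u v _ /and3P[].
Qed.

Lemma comp_sub S S' x : S \subset S' -> component S' x \subset component S x.
Proof.
move=> sub; apply/subsetP=> y; rewrite !inE; apply: connect_sub => u v /and3P[r h1 h2].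
by apply: connect1; rewrite /off r (contra (subsetP sub u) h1) (contra (subsetP sub v) h2).
Qed.

Lemma comp_connected S x r : r \in component S x -> x \notin S ->
  connected_from red r (component S x).
Proof.
move=> rx xS; split=> // X rX cX; apply/subsetP=> y yx.
have : connect (off S) r y by move: yx; rewrite -(comp_eq rx) inE.
move/(@connect_inv _ (off S) (fun z => (z \in X) && (z \in component S x))) => H.
suff /andP[] : (y \in X) && (y \in component S x) by [].
apply: H; last by rewrite rX.
move=> u v /andP[uX ux] uv; have vx := comp_step ux uv.
by rewrite vx (cX u v) //; case/and3P: uv.
Qed.

Definition largest S := \max_(x in ~: S) #|component S x|.
Definition bulk S : {set V} := [set x in ~: S | #|component S x| == largest S].
(** The size of the largest component and the number of vertices in such
    components, compared lexicographically. *)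
Definition spread S := largest S * #|V|.+1 + #|bulk S|.

Lemma le_largest S x : x \notin S -> #|component S x| <= largest S.
Proof. by move=> xS; rewrite /largest (bigmax_sup x) ?inE. Qed.

Lemma mem_bulk S x : (x \in bulk S) = (x \notin S) && (#|component S x| == largest S).
Proof. by rewrite !inE. Qed.

Lemma bulk0 S : bulk S = set0 -> S = setT.
Proof.
move=> b0; have [|] := posnP #|~: S|.
  by move/eqP; rewrite cards_eq0 => /eqP e; rewrite -[S]setCK e setC0.
move/(eq_bigmax_cond (fun x => #|component S x|)) => [x xS e].
suff : x \in bulk S by rewrite b0 inE.
by rewrite mem_bulk /largest e eqxx andbT; move: xS; rewrite inE.
Qed.

Lemma spread_grow S S' x : S \subset S' -> x \in S' -> x \in bulk S ->
  spread S' < spread S.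
Proof.
move=> sub xS' xb.
have le y : #|component S' y| <= #|component S y| by apply/subset_leq_card/comp_sub.
have offS y : y \notin S' -> y \notin S by apply: contra => /(subsetP sub).
have lel : largest S' <= largest S.
  apply/bigmax_leqP=> y; rewrite inE => /offS yS.
  exact: leq_trans (le y) (le_largest yS).
rewrite /spread; move: lel; rewrite leq_eqVlt => /orP[/eqP e|lt].
  rewrite e ltn_add2l; apply/proper_card/properP; split; last first.
    by exists x; rewrite // mem_bulk xS'.
  apply/subsetP=> y; rewrite !mem_bulk e => /andP[/offS yS /eqP ey].
  by rewrite yS eqn_leq le_largest // -ey le.
have : #|bulk S'| <= #|V| by apply: max_card.
have : (largest S').+1 * #|V|.+1 <= largest S * #|V|.+1 by rewrite leq_mul2r lt orbT.
by rewrite mulSn; lia.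
Qed.

(** Outside [D] the components do not change, and inside [D] they stay too
    small to matter. *)
Lemma spread_drop S2 S D y0 : S2 \subset S ->
    (forall z, z \in S -> z \notin S2 -> z \in D) ->
    (forall x y, x \in D -> off S2 x y -> y \in D) ->
    #|D| < largest S -> [disjoint bulk S & D] -> y0 \in bulk S ->
  spread S2 <= spread S.
Proof.
move=> sub SD clD ltD dis y0b.
have outD z : z \notin D -> z \notin S2 -> component S2 z = component S z.
  move=> zD zS2; apply/eqP; rewrite eqEsubset (comp_sub z sub) andbT.
  apply/subsetP=> y; rewrite [y \in component S2 z]inE => zy.
  suff /andP[] : (y \notin D) && (y \in component S z) by [].
  apply: (@connect_inv _ (off S2) (fun t => (t \notin D) && (t \in component S z))) zy _.
    move=> u v /andP[uD uz] uv.
    have vD : v \notin D.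
      by apply: contra uD => vD; apply: clD vD _; rewrite off_sym.
    rewrite vD /=; apply: comp_step uz _; case/and3P: uv => ruv uS2 vS2.
    rewrite /off ruv /=; apply/andP; split.
      by apply: contra uD => uS; apply: SD.
    by apply: contra vD => vS; apply: SD.
  by rewrite zD comp_refl.
have inD z : z \in D -> #|component S2 z| < largest S.
  move=> zD; apply: leq_ltn_trans ltD; apply/subset_leq_card/subsetP=> y.
  by rewrite inE => zy; apply: (@connect_inv _ (off S2) (fun t => t \in D)) zy zD.
have offS z : z \notin D -> z \notin S2 -> z \notin S.
  by move=> zD zS2; apply: contra zD => zS; apply: SD.
have le z : z \notin S2 -> #|component S2 z| <= largest S.
  move=> zS2; have [zD|zD] := boolP (z \in D); first exact/ltnW/inD.
  by rewrite outD // le_largest // offS.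
have lel : largest S2 = largest S.
  apply/eqP; rewrite eqn_leq; apply/andP; split.
    by apply/bigmax_leqP=> z; rewrite inE; apply: le.
  have y0D : y0 \notin D by rewrite (disjointFr dis).
  move: y0b; rewrite mem_bulk => /andP[y0S /eqP<-].
  have y0S2 : y0 \notin S2 by apply: contra y0S => /(subsetP sub).
  by rewrite -outD // le_largest.
rewrite /spread lel leq_add2l; apply/subset_leq_card/subsetP=> z.
rewrite !mem_bulk lel => /andP[zS2 /eqP ez].
have zD : z \notin D by apply/negP=> /inD; rewrite ez ltnn.
by rewrite offS //= -outD // ez.
Qed.

Lemma bulk_comp S y z : y \in bulk S -> z \in component S y -> z \in bulk S.
Proof.
rewrite !mem_bulk => /andP[yS ey] zy.
by rewrite (comp_off yS zy) (comp_eq zy).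
Qed.

Lemma cut_edge (X : {set V}) x y : connect red x y -> x \in X -> y \notin X ->
  exists u v, [/\ u \in X, v \notin X & red u v].
Proof.
move=> xy xX yX.
have [/existsP[u /existsP[v /and3P[uX vX uv]]]|no] :=
  boolP [exists u, exists v, [&& u \in X, v \notin X & red u v]]; first by exists u, v.
suff : y \in X by rewrite (negPf yX).
apply: (@connect_inv _ red (fun z => z \in X)) xy xX => u v uX uv.
apply: contraNT no => vX.
by apply/existsP; exists u; apply/existsP; exists v; rewrite uX vX.
Qed.

Definition comps S := enum [set component S x | x in ~: S].

Lemma compsP S K : reflect (exists2 x, x \notin S & K = component S x) (K \in comps S).
Proof.
rewrite mem_enum; apply: (iffP imsetP) => [[x]|[x xS ->]].
  by rewrite inE => xS ->; exists x.
by exists x; rewrite ?inE.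
Qed.

Lemma comps_in S K x : K \in comps S -> x \in K -> x \notin S /\ K = component S x.
Proof.
by case/compsP=> u uS -> xu; rewrite (comp_eq xu); split; first exact: comp_off xu.
Qed.

Lemma multi_comps S x : multi x (comps S) = (x \notin S).
Proof.
have [xS|xS] := boolP (x \in S).
  apply/eqP; rewrite /multi eqn0Ngt -has_count; apply/hasPn=> K KS.
  by apply/negP=> /(comps_in KS)[]; rewrite xS.
rewrite /multi (eq_in_count (a2 := pred1 (component S x))).
  rewrite count_uniq_mem ?enum_uniq //; congr nat_of_bool.
  by apply/compsP; exists x.
move=> K KS /=; apply/idP/eqP=> [/(comps_in KS)[]//|->]; exact: comp_refl.
Qed.

Lemma comps_system x0 p : (forall x y, connect red x y) ->
    uniq (x0 :: p) -> path red x0 p ->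
  system c x0 p (comps [set x in x0 :: p]).
Proof.
move=> con up pp; set S := [set x in x0 :: p].
have inS x : (x \in S) = (x \in x0 :: p) by rewrite inE.
split=> //.
- by move=> x; rewrite -inS; apply: multi_comps.
- move=> K r /compsP[x xS ->] rx; exact: comp_connected.
- move=> K /compsP[x xS ->].
  have x0x : x0 \notin component S x.
    by apply/negP=> /(comp_off xS); rewrite inS mem_head.
  have [u [v [ux vx uv]]] := cut_edge (con x x0) (comp_refl S x) x0x.
  exists v, u; rewrite red_sym; split=> //; rewrite -inS.
  apply: contraNT vx => vS; apply: (comp_step ux).
  by rewrite /off uv vS (comp_off xS ux).
- move=> K L x y KS LS xK yL rxy.
  have [xS ->] := comps_in KS xK; have [yS ->] := comps_in LS yL.
  apply: comp_eq; rewrite inE; apply: connect1.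
  by rewrite /off red_sym rxy xS yS.
Qed.

(** The blue graph is empty. *)
Lemma path_covers k x0 p : 1 < k -> uniq (x0 :: p) -> path red x0 p ->
  (forall x, x \in x0 :: p) -> covered c k.
Proof.
move=> k1 up pp all_in; have [pb [chb redb]] := path_parent up pp.
have fl n (l : seq (seq V)) : {subset l <= nseq n [::]} -> flatten l = [::].
  elim: l => //= s l IH sub; rewrite IH ?cats0 => [|t tl].
    by have /nseqP[] := sub s (mem_head _ _).
  by apply: sub; rewrite inE tl orbT.
have ft t : flatten (take t (nseq k.+1 [::])) = [::] :> seq V.
  by apply: (fl k.+1) => s /mem_take.
apply: (@cover_from_slices _ c k 0 x0 p pb [::] (nseq k.+1 [::])) => //.
- move=> x xx0; apply: redb; have := all_in x; rewrite inE.
  by rewrite (negPf xx0).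
- by move=> x; rewrite all_in.
- move=> [|//] [|//] _; exists x0, [::]; rewrite mem_head; split=> // x.
- by move=> [|//] [|//].
- by apply: (fl k.+1).
- by rewrite size_nseq.
- by apply/allP=> s /nseqP[-> _]; rewrite /exactly cnt_nil.
- by move=> x; rewrite ft.
- by move=> x; rewrite ft.
- by move=> x; rewrite ft.
Qed.

(** Removing [a] from the path merges [a] and the components that it meets
    into the set [D] of [spread_drop]. *)
Lemma mass_filter_drop S a y0 : a \in S -> y0 \in bulk S ->
    (forall y, y \in bulk S -> ~~ red a y) ->
  largest S <= (mass (filter (meets c a) (comps S))).+1 \/
  spread (S :\ a) <= spread S.
Proof.
move=> aS y0b noa; set Ks := filter _ _.
have [le|lt] := leqP (largest S) (mass Ks).+1; [by left|right].
have inK K x : K \in Ks -> x \in K -> [/\ x \notin S, K = component S x & meets c a K].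
  by rewrite mem_filter => /andP[aK /comps_in H] /H[].
have KD x r : r \in component S x -> red a r -> x \notin S -> x \in union_of Ks.
  move=> rx ar xS; rewrite mem_union_of; apply/hasP; exists (component S x).
    rewrite mem_filter; apply/andP; split; first by apply/exists_inP; exists r.
    by apply/compsP; exists x.
  exact: comp_refl.
have m1 x : multi x Ks <= 1.
  apply: leq_trans (_ : multi x (comps S) <= _); last first.
    by rewrite multi_comps; case: (_ \notin _).
  by rewrite /multi count_filter; apply: sub_count => K /andP[].
apply: (@spread_drop (S :\ a) S (a |: union_of Ks) y0) => //.
- by apply/subsetP=> x /setD1P[].
- by move=> z zS; rewrite !inE zS andbT negbK => ->.
- move=> x y; have [->|ya] := eqVneq y a; first by rewrite setU11.
  rewrite /off !in_setD1 ya /= => xD /and3P[rxy xS yS].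
  rewrite in_setU1 (negPf ya) /=.
  move: xD; rewrite in_setU1 => /orP[/eqP xa|].
    by apply: (KD y y) => //; [exact: comp_refl|rewrite -xa].
  rewrite mem_union_of => /hasP[K KK xK]; have [xS' eK /exists_inP[r rK ar]] := inK K x KK xK.
  have yx : y \in component S x.
    by apply: comp_step (comp_refl S x) _; rewrite /off rxy xS' yS.
  by apply: (KD y r) => //; rewrite (comp_eq yx) -eK.
- have aK : a \notin union_of Ks.
    rewrite mem_union_of; apply/hasPn=> K KK; apply/negP=> /(inK K a KK)[].
    by rewrite aS.
  by rewrite cardsU1 aK card_union_of.
- apply/pred0P=> y /=; apply/negP=> /andP[yb]; rewrite in_setU1 => /orP[/eqP ya|].
    by move: yb; rewrite mem_bulk ya aS.
  rewrite mem_union_of => /hasP[K KK yK]; have [_ eK /exists_inP[r rK ar]] := inK K y KK yK.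
  have /noa : r \in bulk S by apply: (bulk_comp yb); rewrite -eK.
  by rewrite ar.
Qed.

End Extremal.

(** * The extremal path *)

Lemma perm_split3 (T : eqType) (a b : pred T) (l : seq T) :
    {in l, forall x, ~~ (a x && b x)} ->
  perm_eq l (filter a l ++ filter b l ++
             filter (fun x => ~~ a x && ~~ b x) l).
Proof.
move=> ab; apply/permP=> q; rewrite !count_cat.
elim: l ab => //= x l IH ab; rewrite {}IH => [|y yl]; last first.
  by apply: ab; rewrite inE yl orbT.
by have := ab x (mem_head _ _); case: (a x); case: (b x) => //= _; lia.
Qed.

Section Main.
Variables (V : finType) (c : colouring V).
Implicit Types (x y z : V) (K L S D : {set V}).
Local Notation red := (red c).

Lemma mass_cat (cs1 cs2 : seq {set V}) : mass (cs1 ++ cs2) = mass cs1 + mass cs2.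
Proof. by rewrite /mass map_cat sumn_cat. Qed.

Lemma mass_mem (cs : seq {set V}) K : K \in cs -> #|K| <= mass cs.
Proof.
elim: cs => //= L cs IH; rewrite inE /mass /= => /orP[/eqP->|/IH]; rewrite /mass; lia.
Qed.

(** [expose_head] at the first vertex and, after reversing the path, at the
    last one.  The second application needs that the pieces produced by the
    first one do not meet [x1]; they lie in [x0] and the pieces of [As]. *)
Lemma cover_from_two_ends k d x0 p x1 As Zs Fs :
    1 < k -> 0 < d -> p != [::] -> ~~ red x0 x1 ->
    system c x0 (rcons p x1) (As ++ Zs ++ Fs) ->
    (forall K, K \in As -> meets c x0 K) ->
    (forall K, K \in Zs ++ Fs -> ~~ meets c x0 K) ->
    (forall K, K \in Zs -> meets c x1 K) ->
    (forall K, K \in As ++ Fs -> ~~ meets c x1 K) ->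
    (forall K, K \in As ++ Zs -> #|K| < d) ->
    (forall K, K \in Fs -> #|K| <= d) ->
    d <= (mass As).+1 -> d <= (mass Zs).+1 -> d <= mass Fs ->
  covered c k.
Proof.
move=> k1 d0 pn n01 S mA nA mZ nZ ltd led tA tZ tF.
case: p pn S => // y p _ S.
have ltA K : K \in As -> #|K| < d by move=> KA; apply: ltd; rewrite mem_cat KA.
have ltZ K : K \in Zs -> #|K| < d by move=> KZ; apply: ltd; rewrite mem_cat KZ orbT.
have [z0 [q [As' [FA [S' [mA' leFA] tA' subA eb]]]]] := expose_head d0 S mA nA ltA tA.
have nA' K : K \in As' ++ FA -> ~~ meets c x1 K.
  move/subA/subsetP=> sub; apply/negP=> /exists_inP[r /sub rD x1r].
  move: rD; rewrite in_setU1 mem_union_of => /orP[/eqP er|/hasP[L LA rL]].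
    by move: n01; rewrite red_sym -er x1r.
  have LAF : L \in As ++ Fs by rewrite mem_cat LA.
  by move/negP: (nZ L LAF); apply; apply/exists_inP; exists r.
have [y1 [q1 eq1]] : exists y1 q1, rev (z0 :: q) = x1 :: y1 :: q1.
  case: eb => ->; rewrite -!rcons_cons rev_rcons.
    by rewrite rev_cons; case: (rev (y :: p)) => [|y1 q1]; do 2 eexists.
  by rewrite rev_cons; case: (rev p) => [|y1 q1]; do 2 eexists.
have S1 : system c x1 (y1 :: q1) (Zs ++ As' ++ FA ++ Fs).
  apply: system_perm (system_rev eq1 S').
  apply/permP=> a; rewrite !count_cat; lia.
have nR K : K \in As' ++ FA ++ Fs -> ~~ meets c x1 K.
  rewrite catA mem_cat => /orP[/nA'//|KF]; apply: nZ; by rewrite mem_cat KF orbT.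
have [z1 [q' [Zs' [FZ [S2 [mZ' leFZ] tZ' subZ eb']]]]] := expose_head d0 S1 mZ nR ltZ tZ.
have lz : last z1 q' = z0.
  have e : last x1 (y1 :: q1) = z0.
    by have := congr1 (last x1) eq1; rewrite rev_cons last_rcons.
  by case: eb' => [[-> ->]|[-> ->]].
apply: (@cover_from_system _ c k d z1 q' Zs' As' (FZ ++ FA ++ Fs)) => //.
- apply: system_perm S2; apply/permP=> a; rewrite !count_cat; lia.
- by move=> K /mZ'/exists_inP.
- by move=> K /mA'/exists_inP; rewrite lz.
- move=> K; rewrite !mem_cat => /or3P[/leFZ|/leFA|/led] //.
- by rewrite !mass_cat; lia.
Qed.

(** Again lexicographic: the spread first, then the length of the path. *)
Definition potential (b : seq V) := spread c [set x in b] * #|V|.+1 + @size V b.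

(** Induction on the potential: if the path can be improved, the better path
    yields the cover. *)
Lemma cover_path k x0 p : 1 < k -> (forall x y, connect red x y) ->
  uniq (x0 :: p) -> path red x0 p -> covered c k.
Proof.
move=> k1 con; have [n] := ubnP (potential (x0 :: p)).
elim: n x0 p => // n IH x0 p; rewrite ltnS => pot up pp.
set b := x0 :: p in pot up; pose S := [set x in b].
have inS x : (x \in S) = (x \in b) by rewrite inE.
have size_le (q : seq V) : uniq q -> size q <= #|V| by move=> uq; rewrite -(card_uniqP uq); apply: max_card.
have grow x1 q y : uniq (x1 :: q) -> path red x1 q -> {subset b <= x1 :: q} ->
    y \in x1 :: q -> y \in bulk c S -> covered c k.
  move=> uq pq sub yq yb; apply: (IH x1 q) => //; apply: leq_trans pot.
  have lt : spread c [set x in x1 :: q] < spread c S.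
    apply: (@spread_grow _ c S _ y) => //; last by rewrite inE.
    by apply/subsetP=> x; rewrite inS inE => /sub.
  have : (spread c [set x in x1 :: q]).+1 * #|V|.+1 <= spread c S * #|V|.+1.
    by rewrite leq_mul2r lt orbT.
  rewrite /potential mulSn -/S; have := size_le _ uq.
  by move: (_ * _) (_ * _) => s1 s2; lia.
have shrink x1 q : uniq (x1 :: q) -> path red x1 q -> size q < size p ->
    spread c [set x in x1 :: q] <= spread c S -> covered c k.
  move=> uq pq lt le; apply: (IH x1 q) => //; apply: leq_trans pot.
  have : spread c [set x in x1 :: q] * #|V|.+1 <= spread c S * #|V|.+1.
    by rewrite leq_mul2r le orbT.
  rewrite /potential -/S /=; move: (_ * _) (_ * _) => s1 s2; lia.
have [/bulk0 ST|/set0Pn[y0 y0b]] := eqVneq (bulk c S) set0.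
  by apply: path_covers up pp _ => // x; rewrite -[_ \in _]inS ST inE.
have bulkS y : y \in bulk c S -> y \notin b by rewrite mem_bulk inS => /andP[].
(* An end with a red neighbour in [bulk] allows an extension. *)
have [/exists_inP[y yb r0]|/exists_inPn no0] :=
    boolP [exists y in bulk c S, red x0 y].
  apply: (grow y b y) => //.
  - by rewrite /= bulkS.
  - by rewrite /= red_sym r0.
  - by move=> x xb; rewrite inE xb orbT.
  - by rewrite mem_head.
have [/exists_inP[y yb r1]|/exists_inPn no1] :=
    boolP [exists y in bulk c S, red (last x0 p) y].
  apply: (grow x0 (rcons p y) y) => //.
  - by rewrite -rcons_cons rcons_uniq bulkS.
  - by rewrite rcons_path pp.
  - by move=> x xb; rewrite -rcons_cons mem_rcons inE xb orbT.
  - by rewrite -rcons_cons mem_rcons mem_head.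
(* A red edge from [bulk] to the path, used to extend any red cycle
   that contains the path. *)
have [y [v [yb vb ryv]]] : exists y v, [/\ y \in bulk c S, v \in b & red y v].
  have x0n : x0 \notin bulk c S by apply/negP=> /bulkS; rewrite mem_head.
  have [y [v [yb vb ryv]]] := cut_edge (con y0 x0) y0b x0n.
  exists y, v; split=> //; apply: contraNT vb => vb.
  apply: (bulk_comp yb); apply: comp_step (comp_refl c S y) _.
  by rewrite /off ryv !inS vb bulkS.
have on_cycle C : cycle red C -> uniq C -> {subset b <= C} ->
    (forall z, z \in C -> z \notin bulk c S) -> covered c k.
  move=> cC uC sub nb; have [i C' eC] := rot_to (sub v vb).
  have inC z : (z \in v :: C') = (z \in C) by rewrite -eC mem_rot.
  apply: (grow y (v :: C') y) => //; last 2 first.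
  - by move=> z /sub zC; rewrite inE inC zC orbT.
  - by rewrite mem_head.
  - rewrite cons_uniq -eC rot_uniq uC andbT mem_rot.
    by apply/negP=> /nb; rewrite yb.
  - have : cycle red (v :: C') by rewrite -eC rot_cycle.
    by rewrite /= rcons_path ryv => /andP[].
have endin : last x0 p \in b by apply: mem_last.
have vx0 : v != x0.
  by apply: contraNneq (no0 y yb) => <-; rewrite red_sym.
have vx1 : v != last x0 p.
  by apply: contraNneq (no1 y yb) => <-; rewrite red_sym.
have [p' [x1 [ep vp']]] : exists p' x1, p = rcons p' x1 /\ v \in p'.
  move: vb vx1; rewrite inE (negPf vx0) /=; case/lastP: (p) => // p' x1.
  by rewrite mem_rcons last_rcons inE => /orP[->//|vp' _]; exists p', x1.
have el : last x0 p = x1 by rewrite ep last_rcons.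
rewrite el in no1 vx1 endin.
have chord : red x0 x1 -> covered c k.
  move=> r01; apply: (on_cycle b) => // [|z zb].
    by rewrite /= rcons_path pp el red_sym.
  by apply/negP=> /bulkS; rewrite zb.
(* A component that meets both ends closes the path to a cycle. *)
have ring z z' : z \notin S -> z' \in component c S z -> red x0 z -> red x1 z' ->
    covered c k.
  move=> zS z'z rz rz'; have z'S := comp_off zS z'z.
  have zb' t : t \in component c S z -> t \notin bulk c S.
    move=> tz; apply/negP=> tb; have := no0 z; rewrite rz => /implyP.
    rewrite implybF => /negP[]; apply: (bulk_comp tb).
    by rewrite (comp_eq tz) comp_refl.
  have : connect (off c S) z' z.
    by rewrite (sym_connect_sym (off_sym c S)); move: z'z; rewrite inE.
  case/connectP=> q0 /shortenP[q pq uq _] ez.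
  have inq t : t \in z' :: q -> t \in component c S z.
    move=> tq; rewrite -(comp_eq z'z) inE; exact: (path_connect pq).
  have pq' : path red z' q by apply: sub_path pq => a1 a2 /andP[].
  apply: (on_cycle (b ++ z' :: q)).
  - rewrite /= rcons_cat cat_path pp el /= rz' rcons_path pq' -ez /=.
    by rewrite red_sym.
  - rewrite cat_uniq up uq andbT; apply/hasPn=> t /inq tz.
    by rewrite -inS; apply: comp_off tz.
  - by move=> t tb; rewrite mem_cat tb.
  - move=> t; rewrite mem_cat => /orP[tb|/inq/zb'//].
    by apply/negP=> /bulkS; rewrite tb.
have x0S : x0 \in S by rewrite inS mem_head.
have x1S : x1 \in S by rewrite inS.
have x0x1 : x0 != x1.
  by apply: contraTneq up => e; rewrite /b ep /= mem_rcons e mem_head.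
have [mass0|le] := mass_filter_drop x0S y0b no0; last first.
  have [q0 [q eq]] : exists q0 q, p = q0 :: q.
    by rewrite ep; case: (p') => [|q0 q]; do 2 eexists.
  apply: (shrink q0 q); rewrite -?eq.
  - by move: up => /= /andP[].
  - by move: pp; rewrite eq /= => /andP[].
  - by rewrite eq /=.
  - suff -> : [set x in p] = S :\ x0 by [].
    apply/setP=> x; rewrite in_setD1 inS !inE.
    by case: eqVneq => [->|_] //=; move: up => /= /andP[/negPf].
have [mass1|le] := mass_filter_drop x1S y0b no1; last first.
  have eb : b = rcons (x0 :: p') x1 by rewrite /b ep.
  apply: (shrink x0 p').
  - by move: up; rewrite eb rcons_uniq => /andP[].
  - by move: pp; rewrite ep rcons_path => /andP[].
  - by rewrite ep size_rcons.
  - suff -> : [set x in x0 :: p'] = S :\ x1 by [].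
    apply/setP=> x; rewrite in_setD1 inS inE eb mem_rcons [x \in x1 :: _]inE.
    by case: eqVneq => [->|_] //=; move: up; rewrite eb rcons_uniq => /andP[/negPf].
have [r01|n01] := boolP (red x0 x1); first exact: chord.
have [/existsP[z /existsP[z' /and4P[h1 h2 h3 h4]]]|noring] := boolP
    [exists z, exists z', [&& z \notin S, z' \in component c S z, red x0 z & red x1 z']].
  exact: ring h1 h2 h3 h4.
pose cs := comps c S; pose As := filter (meets c x0) cs.
pose Zs := filter (meets c x1) cs.
pose Fs := filter (fun K => ~~ meets c x0 K && ~~ meets c x1 K) cs.
have inAs K : (K \in As) = meets c x0 K && (K \in cs) by apply: mem_filter.
have inZs K : (K \in Zs) = meets c x1 K && (K \in cs) by apply: mem_filter.
have inFs K : (K \in Fs) = (~~ meets c x0 K && ~~ meets c x1 K) && (K \in cs).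
  exact: mem_filter.
have both K : K \in cs -> meets c x0 K -> meets c x1 K -> False.
  case/compsP=> z zS -> /exists_inP[t tz r0] /exists_inP[t' tz' r1].
  move/negP: noring; apply; apply/existsP; exists t; apply/existsP; exists t'.
  by rewrite r0 r1 (comp_off zS tz) (comp_eq tz) tz'.
have pe : perm_eq cs (As ++ Zs ++ Fs).
  by apply: perm_split3 => K Kcs; apply/negP=> /andP[]; apply: both.
have large K : K \in cs -> (meets c x0 K) || (meets c x1 K) -> #|K| < largest c S.
  case/compsP=> z zS -> m; rewrite ltn_neqAle le_largest // andbT.
  apply/negP=> /eqP e; have zb' : z \in bulk c S by rewrite mem_bulk zS e eqxx.
  case/orP: m => /exists_inP[t /(bulk_comp zb') tb rt].
    by have := no0 t tb; rewrite rt.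
  by have := no1 t tb; rewrite rt.
have csF K : K \in cs -> #|K| <= largest c S.
  by case/compsP=> z zS ->; apply: le_largest.
have d0 : 0 < largest c S.
  have y0S : y0 \notin S by rewrite inS bulkS.
  apply: leq_trans (le_largest c y0S); rewrite card_gt0; apply/set0Pn; exists y0.
  exact: comp_refl.
apply: (@cover_from_two_ends k (largest c S) x0 p' x1 As Zs Fs) => //.
- by apply: contraTneq vp' => ->.
- by rewrite -ep; apply: system_perm pe (comps_system con up pp).
- by move=> K; rewrite inAs => /andP[].
- move=> K; rewrite mem_cat inZs inFs => /orP[/andP[m1 Kcs]|/andP[/andP[]]//].
  by apply/negP=> m0; have := both K Kcs m0 m1.
- by move=> K; rewrite inZs => /andP[].
- move=> K; rewrite mem_cat inAs inFs => /orP[/andP[m0 Kcs]|/andP[/andP[]]//].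
  by apply/negP=> m1; have := both K Kcs m0 m1.
- move=> K; rewrite mem_cat inAs inZs.
  by case/orP=> /andP[m Kcs]; apply: large; rewrite ?m ?orbT.
- by move=> K; rewrite inFs => /andP[_]; apply: csF.
- have y0S : y0 \notin S by rewrite inS bulkS.
  move: (y0b); rewrite mem_bulk => /andP[_ /eqP <-]; apply: mass_mem.
  have inc : component c S y0 \in cs by apply/compsP; exists y0.
  rewrite inFs inc andbT -negb_or; apply/negP=> /(large _ inc).
  by move: (y0b); rewrite mem_bulk => /andP[_ /eqP ->]; rewrite ltnn.
Qed.
End Main.

Theorem theorem1p8 (k n : nat) (hk : 2 <= k) (hn : 1 <= n)
    (c : colouring 'I_n) (hred : connected (red_spanning c)) :
  exists T B : graph 'I_n,
    [/\ tree T /\ monochromatic c Red T,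
        #|leaves T| <= k,
        balanced_complete_partite k.+1 B /\ monochromatic c Blue B,
        [disjoint verts T & verts B]
      & verts T :|: verts B = [set: 'I_n]].
Proof.
case: n hn c hred => // n _ c [_ con].
apply: (@cover_path _ c k ord0 [::]) => // x y.
have := con x y (in_setT x) (in_setT y).
apply: connect_sub => u v uv; apply: connect1; move: uv.
rewrite /adj /red inE cards2 => /andP[h ->]; rewrite andbT.
by case: (u != v) h.
Qed.
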